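(* Let $G$ be a simple algebraic group, $H\subset G$ a connected reductive subgroup, $\mathfrak g=\mathfrak h\oplus\mathfrak m$ with $\mathfrak m=\mathfrak h^\perp$, and let $\mathcal O\subset\mathfrak g$ be a nilpotent $G$-orbit. If $\overline{\mathcal O}\cap\mathfrak m=\{0\}$, then $H$ has a dense orbit in $\mathcal O$.
   Context: The ground field is algebraically closed of characteristic $0$. $\mathfrak g=\mathrm{Lie}\,G$, $\mathfrak h=\mathrm{Lie}\,H$, and $\mathfrak m=\mathfrak h^\perp$ is the orthogonal complement of $\mathfrak h$ with respect to the Killing form of $\mathfrak g$. *)

(* Defs.v *)
From HB Require Import structures.
From mathcomp Require Import all_boot all_order all_algebra.
From mathcomp Require Import mpoly.
From mathcomp Require Import boolp classical_sets.

Set Implicit Arguments.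
Unset Strict Implicit.
Unset Printing Implicit Defensive.

Import GRing.Theory.
Local Open Scope classical_set_scope.
Local Open Scope ring_scope.

(* Linear algebraic groups are Zariski closed subgroups of GL_n(k), given by
   their k-points, which determine them since k is algebraically closed. A
   polynomial function on matrices is a polynomial in the n * n entries, the
   entries being numbered by mxvec. *)

Section Zariski.
Variables (k : fieldType) (n : nat).
Implicit Types (X Z : set 'M[k]_n) (p : {mpoly k[n * n]}).

Definition mxeval p (A : 'M[k]_n) : k := p.@[mxvec A 0].

Definition mxdiff p (A X : 'M[k]_n) : k :=
  \sum_(i < n * n) (p^`M(i)).@[mxvec A 0] * mxvec X 0 i.

Definition vanishing_ideal X : set {mpoly k[n * n]} :=
  [set p | forall A, X A -> mxeval p A = 0].

Definition zariski_closure X : set 'M[k]_n :=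
  [set A | forall p, vanishing_ideal X p -> mxeval p A = 0].

Definition zariski_closed Z : Prop := zariski_closure Z = Z.

(* X has no partition into two nonempty relatively closed subsets *)
Definition zariski_connected X : Prop :=
  forall Z1 Z2, zariski_closed Z1 -> zariski_closed Z2 ->
    X `<=` Z1 `|` Z2 -> X `&` (Z1 `&` Z2) = set0 -> X `<=` Z1 \/ X `<=` Z2.

End Zariski.

Section AlgebraicGroups.
Variables (k : fieldType) (n : nat).
Implicit Types (G H N : set 'M[k]_n).

(* The last clause is closedness in GL_n(k), not in the space of matrices. *)
Definition closed_subgroup G : Prop :=
  [/\ G 1%:M,
      forall a b, G a -> G b -> G (a *m b),
      forall a, G a -> G (invmx a) &
      G = zariski_closure G `&` [set a | a \in unitmx]].

Definition Ad (a X : 'M[k]_n) : 'M[k]_n := a *m X *m invmx a.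

Definition normal_subgroup N G : Prop :=
  N `<=` G /\ forall a b, G a -> N b -> N (Ad a b).

(* Simplicity in the sense of algebraic groups: a finite center is allowed. *)
Definition simple_algebraic_group G : Prop :=
  [/\ closed_subgroup G,
      zariski_connected G,
      (exists a b, [/\ G a, G b & a *m b <> b *m a]) &
      forall N, closed_subgroup N -> zariski_connected N ->
        normal_subgroup N G -> N = [set 1%:M] \/ N = G].

Definition nilpotent_mx (X : 'M[k]_n) : Prop := exists d : nat, X ^+ d = 0.

Definition unipotent_group N : Prop :=
  forall a, N a -> nilpotent_mx (a - 1%:M).

(* The unipotent radical, the largest closed connected normal unipotent
   subgroup, is trivial. *)
Definition reductive_group H : Prop :=
  closed_subgroup H /\
  forall N, closed_subgroup N -> zariski_connected N ->
    normal_subgroup N H -> unipotent_group N -> N = [set 1%:M].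

Definition Ad_orbit G (X : 'M[k]_n) : set 'M[k]_n := [set Ad a X | a in G].

End AlgebraicGroups.

Section Subspaces.
Variables (k : fieldType) (V : vectType k).

(* The subspace with P as its set of vectors (junk value 0 if there is none). *)
Definition vspace_of (P : set V) : {vspace V} :=
  xget 0%VS [set U : {vspace V} | forall v, (v \in U) <-> P v].

Lemma mem_vspace_of (P : set V) :
  P 0 -> (forall c u v, P u -> P v -> P (c *: u + v)) ->
  forall v, (v \in vspace_of P) <-> P v.
Proof.
move=> P0 Plin.
pose repr := [set U : {vspace V} | forall v, (v \in U) <-> P v].
suff: exists U, repr U by exact: xgetPex.
have [U UP Umax] : exists2 U : {vspace V}, (forall v, v \in U -> P v) &
    forall v, P v -> v \in U; last first.
  by exists U => v; split=> [/UP|/Umax].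
have grow d (U : {vspace V}) : (dim V - \dim U <= d)%N ->
    (forall v, v \in U -> P v) ->
    exists2 U : {vspace V}, (forall v, v \in U -> P v) &
      forall v, P v -> v \in U.
  elim: d U => [|d IHd] U ledU UP.
    exists U => // v _; suff -> : U = fullv by rewrite memvf.
    apply/eqP; rewrite eqEdim subvf dimvf.
    by rewrite -subn_eq0 -leqn0.
  case: (pselect (forall v, P v -> v \in U)) => [Umax|/existsNP[v]].
    by exists U.
  move=> /not_implyP[Pv /negP vU]; apply: (IHd (<[v]> + U)%VS).
    have lt : (\dim U < \dim (<[v]> + U))%N.
      rewrite (ltn_leqif (dimv_leqif_sup (addvSr _ _))).
      by apply: contra vU => /(subv_trans (addvSl _ _)).
    rewrite -ltnS (leq_trans _ ledU)// ltn_sub2l//.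
    by rewrite (leq_trans lt)// -dimvf dimvS// subvf.
  move=> w /memv_addP[_ /vlineP[c ->] [u uU ->]].
  by apply: Plin => //; exact: UP.
apply: (grow (dim V) 0%VS); first exact: leq_subr.
by move=> v; rewrite memv0 => /eqP ->.
Qed.

End Subspaces.

Section LieAlgebras.
Variables (k : fieldType) (n : nat).
Implicit Types (G : set 'M[k]_n) (g h : {vspace 'M[k]_n}).

(* the tangent space at the identity *)
Definition lie_algebra G : {vspace 'M[k]_n} :=
  vspace_of [set X | forall p, vanishing_ideal G p -> mxdiff p 1%:M X = 0].

Definition lie_bracket (X Y : 'M[k]_n) : 'M[k]_n := X *m Y - Y *m X.

(* The trace of ad X \o ad Y on g, computed in the basis vbasis g; this is
   meaningful when g is closed under the bracket and X, Y lie in g. *)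
Definition killing g (X Y : 'M[k]_n) : k :=
  \sum_(i < \dim g)
    coord (vbasis g) i (lie_bracket X (lie_bracket Y (vbasis g)`_i)).

Definition killing_perp g h : {vspace 'M[k]_n} :=
  vspace_of [set X | X \in g /\ forall Y, Y \in h -> killing g X Y = 0].

Lemma mem_lie_algebra G X :
  X \in lie_algebra G <->
  forall p, vanishing_ideal G p -> mxdiff p 1%:M X = 0.
Proof.
apply: (mem_vspace_of (P := [set X | _])) => /= [p _|c u v Pu Pv p Ip].
  by rewrite /mxdiff linear0 big1// => i _; rewrite mxE mulr0.
rewrite /mxdiff linearP/=.
under eq_bigr do rewrite !mxE mulrDr mulrCA.
by rewrite big_split/= -mulr_sumr [X in c * X]Pu// [X in _ + X]Pv// mulr0 addr0.
Qed.

Lemma mem_killing_perp g h X :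
  X \in killing_perp g h <->
  X \in g /\ forall Y, Y \in h -> killing g X Y = 0.
Proof.
apply: (mem_vspace_of (P := [set X | _])) => /=.
  split=> [|Y _]; first exact: mem0v.
  by rewrite /killing big1// => i _; rewrite /lie_bracket mul0mx mulmx0 subr0 linear0.
move=> c u v [ug u0] [vg v0]; split=> [|Y Yh]; first by rewrite memvD// memvZ.
have brL Z : lie_bracket (c *: u + v) Z = c *: lie_bracket u Z + lie_bracket v Z.
  rewrite /lie_bracket mulmxDl mulmxDr -scalemxAl -scalemxAr scalerBr.
  by rewrite opprD addrACA.
rewrite /killing; under eq_bigr do rewrite brL linearP/=.
by rewrite big_split/= -mulr_sumr [X in c * X]u0// [X in _ + X]v0// mulr0 addr0.
Qed.

(* For G semisimple, being nilpotent as a matrix is the same as being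
   ad-nilpotent in Lie G. *)
Definition nilpotent_orbit G (O : set 'M[k]_n) : Prop :=
  exists e, [/\ e \in lie_algebra G, nilpotent_mx e & O = Ad_orbit G e].

Definition has_dense_orbit (H O : set 'M[k]_n) : Prop :=
  exists2 x, O x &
    Ad_orbit H x `<=` O /\ O `<=` zariski_closure (Ad_orbit H x).

End LieAlgebras.

(* Main.v *)
Require Import Defs.
From HB Require Import structures.
From mathcomp Require Import all_boot all_order all_algebra.
From mathcomp Require Import mpoly ring.
From mathcomp Require Import boolp classical_sets.

Import GRing.Theory.
Local Open Scope classical_set_scope.
Local Open Scope ring_scope.

Set Implicit Arguments.
Unset Strict Implicit.
Unset Printing Implicit Defensive.

(* The tangent space of O at x is [g, x]. If [g, x] met m nontrivially at every
   x in O, there would be a nonzero vector field D along O tangent to the fibres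
   of the projection of g onto h along m. The fibre over 0 of the closure of O
   is {0}; modulo powers of the ideal defining this fibre every function z is a
   root of a monic polynomial of bounded degree whose coefficients are killed
   by D, and differentiating that relation until a nonzero constant is left
   puts a power of D z in all powers of the ideal. By Krull's intersection
   theorem D z vanishes near 0, hence on O: a contradiction.
   So [g, x] meets m trivially for some x in O, and invariance of the Killing
   form then gives [h, x] = [g, x]. Consequently the ideal of H x is stable
   under g, so that for p in this ideal the function a |-> p(a x a^-1) on G
   vanishes to infinite order at 1; as G is connected, it vanishes. *)

(** * Noetherian rings and Krull's intersection theorem *)

(** Irreducibility of the orbit enters through connectedness of [G]: a function on the orbit is
    pulled back along a |-> a x a^-1, made polynomial by a power of the determinant, and vanishing
    then spreads from a neighbourhood of one point of [G] to all of it. The point 0 lies in the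
    closure of the orbit but in general not in the orbit; it still serves as centre because a
    polynomial that is nonzero at 0 is nonzero somewhere on the orbit. Krull's theorem applies
    because one exponent works modulo every power of the ideal: a spanning set modulo the first
    power also spans, with coefficients killed by D, modulo all higher ones. Characteristic 0 is
    used to divide by m!, the m-th derivative of a monic polynomial of degree m, and by j in Euler's
    formula for forms of degree j. *)

Section Ideals.
Variable R : comNzRingType.
Implicit Types (I : set R) (a b r : R).

Definition ideal I : Prop :=
  [/\ I 0, forall a b, I a -> I b -> I (a + b) & forall r a, I a -> I (r * a)].

Lemma ideal_sum I (T : Type) (s : seq T) (P : pred T) (F : T -> R) :
  ideal I -> (forall i, P i -> I (F i)) -> I (\sum_(i <- s | P i) F i).
Proof. by move=> [I0 ID _] IF; apply: big_ind. Qed.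

Lemma idealN I a : ideal I -> I a -> I (- a).
Proof. by move=> [_ _ IM] Ia; rewrite -mulN1r; apply: IM. Qed.

Lemma idealB I a b : ideal I -> I a -> I b -> I (a - b).
Proof. by move=> Iid Ia Ib; have [_ ID _] := Iid; apply: ID => //; apply: idealN. Qed.

Lemma idealBD I a b c d : ideal I -> I (a - c) -> I (b - d) -> I (a + b - (c + d)).
Proof. by move=> [_ ID _] Iac Ibd; rewrite opprD addrACA; apply: ID. Qed.

Lemma idealMr I a r : ideal I -> I a -> I (a * r).
Proof. by move=> [_ _ IM] Ia; rewrite mulrC; apply: IM. Qed.

(* The ascending chain condition for the ideals (u_0, .., u_(N-1)). *)
Definition noetherian : Prop :=
  forall u : nat -> R, exists N (c : 'I_N -> R), u N = \sum_(i < N) c i * u i.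

(** Otherwise choice builds a strictly increasing chain of ideals, and picking a new element at each
    stage gives a sequence that violates [noetherian]. *)
Lemma noetherian_max_ideal (P : set R -> Prop) I :
  noetherian -> ideal I -> P I ->
  exists M, [/\ ideal M, I `<=` M, P M &
    forall M', ideal M' -> M `<=` M' -> P M' -> M' `<=` M].
Proof.
move=> noeth Iid PI; apply: contrapT => nomax.
pose T := {J : set R | [/\ ideal J, I `<=` J & P J]}.
have step (J : T) : exists J' : T, sval J `<=` sval J' /\
    exists x, sval J' x /\ ~ sval J x.
  case: J => J [Jid IJ PJ] /=; apply: contrapT => nostep.
  apply: nomax; exists J; split=> // M' M'id JM' PM' x M'x.
  apply: contrapT => nJx; apply: nostep.
  have HM' : [/\ ideal M', I `<=` M' & P M'] by split=> // y /IJ /JM'.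
  by exists (exist _ M' HM'); split=> //=; exists x.
pose nxt J := sval (cid (step J)).
have nxtP J : sval J `<=` sval (nxt J) /\ exists x, sval (nxt J) x /\ ~ sval J x.
  by rewrite /nxt; case: cid.
have HI : [/\ ideal I, I `<=` I & P I] by split.
pose J i := iter i nxt (exist _ I HI).
pose u i := sval (cid (nxtP (J i)).2).
have uP i : sval (J i.+1) (u i) /\ ~ sval (J i) (u i).
  by rewrite /u; case: cid.
have Jmono i d : sval (J i) `<=` sval (J (i + d)%N).
  elim: d => [|d IHd]; first by rewrite addn0.
  by rewrite addnS => x /IHd Jx; apply: (nxtP _).1.
have [N [c uN]] := noeth u.
have [_] := uP N; rewrite uN; apply.
have [JNid _ _] := svalP (J N).
apply: ideal_sum => // i _; have [_ _ JM] := JNid; apply: JM.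
have := Jmono i.+1 (N - i.+1)%N; rewrite subnKC //; apply.
exact: (uP i).1.
Qed.

End Ideals.

(** * Hilbert's basis theorem *)

Section HilbertBasis.

Lemma noetherian_image (R S : comNzRingType) (f : {rmorphism R -> S}) :
  noetherian R -> (forall y, exists x, f x = y) -> noetherian S.
Proof.
move=> noeth fsurj u.
pose v i := sval (cid (fsurj (u i))).
have vP i : f (v i) = u i by rewrite /v; case: cid.
have [N [c vN]] := noeth v; exists N, (fun i => f (c i)).
rewrite -vP vN rmorph_sum; apply: eq_bigr => i _.
by rewrite rmorphM/= vP.
Qed.

Variable R : comNzRingType.

Let gen (u : nat -> {poly R}) N : set {poly R} :=
  [set f | exists c : 'I_N -> {poly R}, f = \sum_(i < N) c i * u i].

Let gen_ideal u N : ideal (gen u N).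
Proof.
split=> [|_ _ [c ->] [d ->]|r _ [c ->]].
- by exists (fun=> 0); rewrite big1// => i _; rewrite mul0r.
- exists (fun i => c i + d i); rewrite -big_split; apply: eq_bigr => i _.
  by rewrite mulrDl.
- exists (fun i => r * c i); rewrite mulr_sumr; apply: eq_bigr => i _.
  by rewrite mulrA.
Qed.

Let gen_mem u N i : (i < N)%N -> gen u N (u i).
Proof.
move=> ltiN; exists (fun j => (j == Ordinal ltiN)%:R).
rewrite (bigD1 (Ordinal ltiN))//= eqxx mul1r big1 ?addr0// => j /negPf ->.
by rewrite mul0r.
Qed.

Let gen_sub u N (J : set {poly R}) :
  ideal J -> (forall i, (i < N)%N -> J (u i)) -> gen u N `<=` J.
Proof.
move=> Jid Ju _ [c ->]; apply: ideal_sum => // i _.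
by have [_ _ JM] := Jid; apply: JM; apply: Ju.
Qed.

(** If [u] is a counterexample, the ideal [J] generated by all its terms is not finitely generated.
    Let g_n be of least size in [J] outside (g_0, .., g_(n-1)); a relation between the leading
    coefficients then produces an element smaller than some g_N, against minimality. *)
Lemma noetherian_poly : noetherian R -> noetherian {poly R}.
Proof.
move=> noeth u; apply: contrapT => nofin.
have uN N : ~ gen u N (u N) by move=> [c uE]; apply: nofin; exists N, c.
pose J f := exists N, gen u N f.
have genW N M : (N <= M)%N -> gen u N `<=` gen u M.
  move=> leNM; apply: gen_sub (gen_ideal _ _) _ => i ltiN.
  by apply: gen_mem; apply: leq_trans leNM.
have Jid : ideal J.
  split=> [|a b [N Na] [M Mb]|r a [N Na]].
  - by exists 0%N; have [] := gen_ideal u 0.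
  - exists (maxn N M); have [_ D _] := gen_ideal u (maxn N M).
    by apply: D; [apply: genW Na|apply: genW Mb]; rewrite ?leq_maxl ?leq_maxr.
  - by exists N; have [_ _ M] := gen_ideal u N; apply: M.
pose out (v : nat -> {poly R}) N g := J g /\ ~ gen v N g.
have Jfg v N : (forall i, (i < N)%N -> J (v i)) -> exists g, out v N g.
  move=> Jv; apply: contrapT => noout.
  suff [M subM] : exists M, gen v N `<=` gen u M.
    apply: (uN M); apply: subM; apply: contrapT => nv; apply: noout.
    by exists (u M); split=> //; exists M.+1; apply: gen_mem.
  elim: N Jv {noout} => [|N IHN] Jv.
    by exists 0%N; apply: gen_sub (gen_ideal _ _) _.
  have [|M subM] := IHN; first by move=> i ltiN; apply: Jv; apply: ltnW.
  have [M' vM'] := Jv N (leqnn _).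
  exists (maxn M M'); apply: gen_sub (gen_ideal _ _) _ => i.
  rewrite ltnS leq_eqVlt => /orP[/eqP ->|ltiN].
    by apply: genW vM'; apply: leq_maxr.
  by apply: (genW M); rewrite ?leq_maxl//; apply/subM/gen_mem.
(* The conditional form lets [nxt] be defined on every list; [gP] checks the condition along the
   recursion. *)
have minout v N : exists g, (exists g, out v N g) ->
    out v N g /\ forall g', out v N g' -> (size g <= size g')%N.
  case: (pselect (exists g, out v N g)) => [[g0 g0P]|nog]; last first.
    by exists 0 => /nog.
  pose sz k := `[< exists2 g, out v N g & size g = k >].
  have exsz : exists k, sz k by exists (size g0); apply/asboolP; exists g0.
  case: (ex_minnP exsz) => k /asboolP[g gP gk] kmin.
  exists g => _; split=> // g' g'P; rewrite gk; apply: kmin.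
  by apply/asboolP; exists g'.
pose nxt (s : seq {poly R}) := sval (cid (minout (nth 0 s) (size s))).
(* Each choice depends on all the earlier ones, so the recursion runs on the list of these. *)
pose L := fix L n := if n is m.+1 then rcons (L m) (nxt (L m)) else [::].
pose g n := nxt (L n).
have sizeL n : size (L n) = n by elim: n => //= n IHn; rewrite size_rcons IHn.
have nthL n i : (i < n)%N -> nth 0 (L n) i = g i.
  elim: n => // n IHn; rewrite ltnS leq_eqVlt /= nth_rcons sizeL.
  by case/orP => [/eqP ->|ltin]; rewrite ?ltnn ?eqxx ?ltin ?IHn.
have genL n : gen (nth 0 (L n)) n = gen g n.
  apply/seteqP; split; apply: gen_sub (gen_ideal _ _) _ => i ltin.
    by rewrite nthL//; apply: gen_mem.
  by rewrite -(nthL n)//; apply: gen_mem.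
have gP n : out g n (g n) /\ forall g', out g n g' -> (size (g n) <= size g')%N.
  elim/ltn_ind: n => n IHn; 
  have := svalP (cid (minout (nth 0 (L n)) (size (L n)))).
  rewrite -/(nxt (L n)) -/(g n) sizeL /out genL; apply; apply: Jfg => i ltin.
  by have [[]] := IHn i ltin.
have [N [c leadN]] := noeth (fun i => lead_coef (g i)).
have [[JgN ngN] minN] := gP N.
(* g_N also lies outside the smaller ideal (g_0, .., g_(i-1)), so it competed with g_i. *)
have szg (i : 'I_N) : (size (g i) <= size (g N))%N.
  apply: (gP i).2; split=> // geni; apply: ngN; move: geni.
  apply: (gen_sub (J := gen g N)) => // j ltji.
  by apply: gen_mem; apply: ltn_trans ltji _.
have gN0 : g N != 0.
  by apply: contra_notN ngN => /eqP ->; have [] := gen_ideal g N.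
(* The powers of X align the leading terms, so [h] has the leading term of g_N. *)
pose h := \sum_(i < N) c i *: 'X^(size (g N) - size (g i)) * g i.
have genh : gen g N h by exists (fun i => c i *: 'X^(size (g N) - size (g i))).
have : out g N (g N - h).
  split.
    apply: idealB => //; move: genh; apply: (gen_sub (J := J)) => // i _.
    by have [[]] := gP i.
  move=> gengh; apply: ngN; rewrite -(subrK h (g N)).
  by have [_ D _] := gen_ideal g N; apply: D.
move=> /minN; apply/negP; rewrite -ltnNge.
have szN : (size (g N)).-1.+1 = size (g N) by rewrite prednK ?size_poly_gt0.
rewrite -szN ltnS; apply/leq_sizeP => j.
rewrite leq_eqVlt => /orP[/eqP <-|]; last first.
  rewrite szN => ltj; apply/leq_sizeP: j ltj.
  rewrite (leq_trans (size_polyD _ _))// geq_max leqnn size_polyN.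
  rewrite (leq_trans (size_sum _ _ _))//; apply/bigmax_leqP => i _.
  rewrite -scalerAl (leq_trans (size_scale_leq _ _))// mulrC.
  have [->|gi0] := eqVneq (g i) 0; first by rewrite mul0r size_poly0.
  by rewrite size_Mmonic ?monicXn// size_polyXn addnS /= subnKC// szg.
rewrite coefB coef_sum -lead_coefE leadN -sumrB big1// => i _.
rewrite -scalerAl coefZ mulrC coefXnM; case: ltnP => [ltj|lej].
  have [->|gi0] := eqVneq (g i) 0; first by rewrite lead_coef0 mul0r mulr0 subr0.
  have gi1 : (0 < size (g i))%N by rewrite size_poly_gt0.
  by move: ltj; rewrite ltnNge -subn1 leq_sub2l.
have [->|gi0] := eqVneq (g i) 0; first by rewrite lead_coef0 coef0 mulr0 mul0r subr0.
have gi1 : (0 < size (g i))%N by rewrite size_poly_gt0.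
rewrite [lead_coef (g i)]lead_coefE.
have -> : ((size (g N)).-1 - (size (g N) - size (g i)))%N = (size (g i)).-1.
  by rewrite -!subn1 subnAC subKn.
by rewrite mulrC subrr.
Qed.
End HilbertBasis.

(** For inductions on the number of variables: surjectivity is enough to transport the Noetherian
    property and to pull back prime ideals. *)
Lemma poly_mpoly_morphism (R : comNzRingType) n :
  exists f : {rmorphism {poly {mpoly R[n]}} -> {mpoly R[n.+1]}},
  [/\ forall c, f c%:P = mwiden c, f 'X = 'X_ord_max &
    forall p, exists q, f q = p].
Proof.
pose f : {rmorphism {poly {mpoly R[n]}} -> {mpoly R[n.+1]}} :=
  horner_eval ('X_ord_max : {mpoly R[n.+1]}) \o map_poly (@mwiden n R).
have fC c : f c%:P = mwiden c by rewrite /f/= map_polyC /horner_eval hornerC.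
have fX : f 'X = 'X_ord_max by rewrite /f/= map_polyX /horner_eval hornerX.
exists f; split=> //; move: (f) fC fX => {}f fC fX p.
elim/mpolyind: p => [|c m p _ _ [q <-]]; first by exists 0; rewrite rmorph0.
exists ((c *: 'X_[[multinom m (widen_ord (leqnSn n) i) | i < n]])%:P *
  'X^(m ord_max) + q).
rewrite rmorphD rmorphM rmorphXn fC fX; congr (_ + _).
rewrite mwidenZ mwidenX -scalerAl; congr (_ *: _).
rewrite mpolyXn -mpolyXD; congr 'X_[_]; apply/mnmP => i.
have [j ->|->] := unliftP ord_max i.
  rewrite mnmDE mulmnE mnm1E (negPf (neq_lift _ _)) mul0n addn0.
  have -> : lift ord_max j = widen_ord (leqnSn n) j.
    by apply: val_inj; rewrite /= /bump leqNgt ltn_ord.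
  by rewrite mnmwiden_widen mnmE.
by rewrite mnmDE mulmnE mnm1E eqxx mul1n mnmwiden_ordmax.
Qed.

Lemma noetherian_mpoly (R : comNzRingType) n :
  noetherian R -> noetherian {mpoly R[n]}.
Proof.
move=> noeth; elim: n => [|n IHn].
  apply: (noetherian_image (f := @mpolyC 0 R)) => // p; exists p@_0.
  by apply/mpolyP => m; rewrite mcoeffC; have -> : m = 0%MM
    by [apply/mnmP => -[]]; rewrite eqxx mulr1.
have [f [_ _ fsurj]] := poly_mpoly_morphism R n.
exact: noetherian_image (noetherian_poly IHn) fsurj.
Qed.

(** * Powers of an ideal and Krull's theorem *)

Section IdealPowers.
Variables (R : comNzRingType) (s : nat) (y : 'I_s -> R).
Implicit Types (a b r : R).

(* ipow j is the ideal (y_1, .., y_s)^j. *)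
Inductive ipow : nat -> R -> Prop :=
| ipow_0 j : ipow j 0
| ipow_top r : ipow 0 r
| ipow_gen j i r : ipow j r -> ipow j.+1 (y i * r)
| ipow_D j a b : ipow j a -> ipow j b -> ipow j (a + b).

Lemma ipow_Ml j r a : ipow j a -> ipow j (r * a).
Proof.
elim=> {j a} [j|a|j i a _ IH|j a b _ IHa _ IHb].
- by rewrite mulr0; apply: ipow_0.
- exact: ipow_top.
- by rewrite mulrCA; apply: ipow_gen.
- by rewrite mulrDr; apply: ipow_D.
Qed.

Lemma ipow_ideal j : ideal (ipow j).
Proof. by split; [exact: ipow_0|exact: ipow_D|exact: ipow_Ml]. Qed.

Lemma ipow_M i j a b : ipow i a -> ipow j b -> ipow (i + j) (a * b).
Proof.
move=> ia jb; elim: ia => {i a} [i|a|i l a _ IH|i a a' _ IHa _ IHa'].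
- by rewrite mul0r; apply: ipow_0.
- exact: ipow_Ml.
- by rewrite -mulrA addSn; apply: ipow_gen.
- by rewrite mulrDl; apply: ipow_D.
Qed.

Lemma ipow_leS j a : ipow j.+1 a -> ipow j a.
Proof.
move Ej: j.+1 => l la; elim: la j Ej => {l a} [l|//|l i a la _|l a b _ IHa _ IHb] j.
- by move=> _; apply: ipow_0.
- by case=> ->; apply: ipow_Ml.
- by move=> E; apply: ipow_D; [apply: IHa|apply: IHb].
Qed.

Lemma ipow1_gen i : ipow 1 (y i).
Proof. by rewrite -[y i]mulr1; apply/ipow_gen/ipow_top. Qed.

Lemma ipow_homog j a : ipow j a ->
  exists2 P : {mpoly R[s]}, P \is j.-homog & P.@[y] = a.
Proof.
elim=> {j a} [j|a|j i a _ [P Ph <-]|j a b _ [P Ph <-] _ [Q Qh <-]].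
- by exists 0; [exact: dhomog0|rewrite meval0].
- exists (a *: 1); last by rewrite mevalZ meval1 mulr1.
  exact/dhomogZ/dhomog1.
- exists ('X_i * P); last by rewrite mevalM mevalXU.
  by rewrite -add1n; apply: dhomogM; rewrite // dhomogX /= mdeg1.
- by exists (P + Q); [exact: dhomogD|rewrite mevalD].
Qed.

Lemma homog_ipow1 j (P : {mpoly R[s]}) :
  P \is j.+1.-homog -> ipow 1 P.@[y].
Proof.
move=> Ph; rewrite mevalE big_seq; apply: ideal_sum (ipow_ideal _) _ => m mP.
apply: ipow_Ml; have /= := dhomog_mf Ph mP.
rewrite mdegE => mj; have [i mi] : exists i, m i != 0%N.
  apply: contrapT => noi; move: mj; rewrite big1// => i _.
  by apply/eqP; apply: contrapT => mi; apply: noi; exists i; apply/negP.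
rewrite (bigD1 i)//= mulrC; apply: ipow_Ml.
by case: (m i) mi => // k _; rewrite exprSr; apply/ipow_Ml/ipow1_gen.
Qed.

(** The ideal I + (y_1, .., y_s)^j. *)
Definition ipow_mod (I : set R) j : set R :=
  [set a | exists2 q, ipow j q & I (a - q)].

Lemma ipow_mod_ideal I j : ideal I -> ideal (ipow_mod I j).
Proof.
move=> Iid; have [I0 ID IM] := Iid.
split=> [|a b [p jp Ip] [q jq Iq]|r a [p jp Ip]].
- by exists 0; [exact: ipow_0|rewrite subr0].
- exists (p + q); first exact: ipow_D.
  by rewrite opprD addrACA; apply: ID.
- exists (r * p); first exact: ipow_Ml.
  by rewrite -mulrBr; apply: IM.
Qed.

Lemma ipow_modW I j : ideal I -> ipow j `<=` ipow_mod I j.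
Proof. by move=> [I0 _ _] a ja; exists a; rewrite ?subrr. Qed.

Lemma ipow_mod_sub I j : ideal I -> I `<=` ipow_mod I j.
Proof. by move=> Iid a Ia; exists 0; [exact: ipow_0|rewrite subr0]. Qed.

Lemma ipow_mod_M I i j a b :
  ideal I -> ipow_mod I i a -> ipow j b -> ipow_mod I (i + j) (a * b).
Proof.
move=> Iid [p ip Ip] jb; exists (p * b); first exact: ipow_M.
by rewrite -mulrBl; apply: idealMr.
Qed.

Lemma ipow_rmorph0 (R' : comNzRingType) (phi : {rmorphism R -> R'}) j a :
  (forall i, phi (y i) = 0) -> ipow j.+1 a -> phi a = 0.
Proof.
move=> phiy; move Ej: j.+1 => l la.
elim: la j Ej => {l a} [l|//|l i a _ _|l a b _ IHa _ IHb] j Ej.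
- by rewrite rmorph0.
- by rewrite rmorphM phiy mul0r.
- by rewrite rmorphD (IHa _ Ej) (IHb _ Ej) addr0.
Qed.

End IdealPowers.

Lemma pihomogMr (R : comNzRingType) s d e (P q : {mpoly R[s]}) :
  P \is e.-homog -> (e <= d)%N ->
  pihomog mdeg d (q * P) = pihomog mdeg (d - e) q * P.
Proof.
move=> Ph led; elim/mpolyind: q => [|c m q _ _ IHq].
  by rewrite mul0r !linear0 mul0r.
rewrite mulrDl !linearD/= mulrDl IHq -scalerAl !linearZ/= -scalerAl.
congr (_ *: _ + _); rewrite pihomogX.
have homM : 'X_[m] * P \is (mdeg m + e).-homog.
  by apply: dhomogM => //; rewrite dhomogX.
have [mE|mN] := eqVneq (mdeg m) (d - e)%N.
  by rewrite pihomog_dE//; move: homM; rewrite mE subnK.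
rewrite mul0r (pihomog_ne0 _ homM)//.
by apply: contra mN => /eqP <-; rewrite addnK.
Qed.

(* Perdry's argument: writing f as a form P_j of each degree j in the
   generators, the Noetherian property of R[Y] expresses some P_N through
   the P_j with j < N, and the degree N part of that relation reads
   f = a f modulo I. *)
Lemma krull_intersection (R : comNzRingType) s (y : 'I_s -> R) (I : set R) f :
  noetherian R -> ideal I -> (forall j, ipow_mod y I j f) ->
  exists2 a, ipow y 1 a & I (f * (1 - a)).
Proof.
move=> noeth Iid fI; have [I0 ID IM] := Iid.
have ex j : exists P : {mpoly R[s]}, P \is j.-homog /\ I (f - P.@[y]).
  by have [q /ipow_homog[P Ph <-] Iq] := fI j; exists P.
pose P j := sval (cid (ex j)).
have Ph j : P j \is j.-homog by rewrite /P; case: cid => ? [].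
have PI j : I (f - (P j).@[y]) by rewrite /P; case: cid => ? [].
have [N [c PN]] := noetherian_mpoly (n := s) noeth P.
(* In degree N, only the part of c_i of degree N - i contributes; this degree is positive, which
   puts [a] in (y). *)
pose a := \sum_(i < N) (pihomog mdeg (N - i) (c i)).@[y].
have PNy : (P N).@[y] = \sum_(i < N) (pihomog mdeg (N - i) (c i)).@[y] * (P i).@[y].
  rewrite -(pihomog_dE (Ph N)) PN [pihomog _ _ _]linear_sum raddf_sum.
  by apply: eq_bigr => i _ /=; rewrite (pihomogMr _ (Ph i)) ?mevalM// ltnW.
exists a.
  apply: ideal_sum (ipow_ideal _ _) _ => i _.
  apply: (@homog_ipow1 _ _ _ (N - i).-1); rewrite prednK ?subn_gt0//.
  exact: pihomogP.
have -> : f * (1 - a) = (f - (P N).@[y]) -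
    \sum_(i < N) (pihomog mdeg (N - i) (c i)).@[y] * (f - (P i).@[y]).
  rewrite PNy mulrBr mulr1 -addrA -opprD -big_split/=; congr (_ - _).
  rewrite mulrC mulr_suml; apply: eq_bigr => i _.
  by rewrite mulrBr addrCA subrr addr0.
by apply: idealB => //; apply: ideal_sum => // i _; apply: IM.
Qed.

(** * Hilbert's Nullstellensatz *)

Section PointsOfPrimeIdeals.

Definition prime_ideal (R : comNzRingType) (P : set R) : Prop :=
  [/\ ideal P, ~ P 1 & forall a b, P (a * b) -> P a \/ P b].

Lemma prime_idealX (R : comNzRingType) (P : set R) a n :
  prime_ideal P -> P (a ^+ n) -> P a.
Proof.
move=> [_ P1 PM]; elim: n => [|n IHn]; first by rewrite expr0.
by rewrite exprS => /PM[].
Qed.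

Lemma prime_ideal_preim (R R' : comNzRingType) (f : {rmorphism R -> R'})
    (P : set R') : prime_ideal P -> prime_ideal (f @^-1` P).
Proof.
move=> [[PO PD PM] P1 PMul]; split=> [||x y]; rewrite /preimage/=.
- split=> [|x y Px Py|r x Px] /=; first by rewrite rmorph0.
    by rewrite rmorphD; apply: PD.
  by rewrite rmorphM; apply: PM.
- by rewrite rmorph1.
- by rewrite rmorphM; apply: PMul.
Qed.

(** The bound on the quotient serves in [prime_ideal_extend_point], where it makes q smaller than a
    minimal element of P. *)
Lemma pseudo_division (R : comNzRingType) (h f : {poly R}) : h != 0 ->
  exists N q r, [/\ lead_coef h ^+ N *: f = q * h + r, (size r < size h)%N &
    (size q <= (size f).+1 - size h)%N].
Proof.
move=> h0; have [m] := ubnP (size f); elim: m f => // m IHm f; rewrite ltnS => fm.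
have [ltfh|lehf] := ltnP (size f) (size h).
  by exists 0%N, 0, f; rewrite expr0 scale1r mul0r add0r size_poly0.
have h1 : (0 < size h)%N by rewrite size_poly_gt0.
have f1 : (0 < size f)%N := leq_trans h1 lehf.
pose e := (size f - size h)%N.
pose f' := lead_coef h *: f - lead_coef f *: 'X^e * h.
have szf' : (size f' < size f)%N.
  rewrite -(prednK f1) ltnS; apply/leq_sizeP => j.
  rewrite leq_eqVlt => /orP[/eqP <-|].
    rewrite coefB coefZ -scalerAl coefZ coefXnM ltnNge -subn1 leq_sub2l//=.
    have -> : (size f - 1 - e)%N = (size h).-1 by rewrite subnAC subKn// subn1.
    by rewrite subn1 -!lead_coefE mulrC subrr.
  rewrite prednK// => ltj; apply/leq_sizeP: j ltj.
  rewrite (leq_trans (size_polyD _ _))// geq_max size_polyN.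
  rewrite (leq_trans (size_scale_leq _ _))//= -scalerAl.
  rewrite (leq_trans (size_scale_leq _ _))// mulrC size_Mmonic ?monicXn//.
  by rewrite size_polyXn addnS subnKC.
have [|N [q [r [Ef' szr szq]]]] := IHm f'; first exact: leq_trans fm.
exists N.+1, (q + lead_coef h ^+ N *: (lead_coef f *: 'X^e)), r; split=> //.
  rewrite mulrDl addrAC -Ef' exprSr -scalerA -scalerAl -scalerDr.
  by rewrite /f' subrK.
rewrite (leq_trans (size_polyD _ _))// geq_max (leq_trans szq) /=; last first.
  by rewrite leq_sub2r// ltnW.
rewrite (leq_trans (size_scale_leq _ _))// (leq_trans (size_scale_leq _ _))//.
by rewrite size_polyXn subSn.
Qed.

Variables (R : comNzRingType) (P : set {poly R}).
Hypothesis Pprime : prime_ideal P.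

(** [P0] is the contraction of P to R, and [P0X] is P0[X]: the polynomials that become zero over the
    fraction field of R / P0. *)
Let P0 : set R := [set r | P r%:P].
Let P0X (f : {poly R}) := forall i, P0 f`_i.

Let P_P0X f : P0X f -> P f.
Proof.
have [Pid _ _] := Pprime => f0; rewrite -(coefK f) poly_def.
apply: ideal_sum => // i _; rewrite -mul_polyC mulrC.
by have [_ _ PM] := Pid; apply/PM/f0.
Qed.

(** Such an h generates Q over the fraction field of R / P0. Were its leading coefficient in [P0],
    dropping the leading term would give a smaller element of Q outside [P0X]. *)
Let minimal_element (Q : set {poly R}) f :
  ideal Q -> P `<=` Q -> Q f -> ~ P0X f ->
  exists h, [/\ Q h, ~ P0 (lead_coef h) &
    forall r, Q r -> (size r < size h)%N -> P0X r].
Proof.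
move=> Qid PQ Qf nf; pose sz m := `[< exists2 h, Q h /\ ~ P0X h & size h = m >].
have exsz : exists m, sz m by exists (size f); apply/asboolP; exists f.
case: (ex_minnP exsz) => m /asboolP[h [Qh nh] hm] mmin.
have hmin r : Q r -> (size r < size h)%N -> P0X r.
  move=> Qr ltrh; apply: contrapT => nr; move: ltrh; rewrite hm ltnNge.
  by move=> /negP; apply; apply: mmin; apply/asboolP; exists r.
exists h; split=> // Ph.
have h0 : h != 0.
  apply: contra_notN nh => /eqP -> i; rewrite coef0 /P0/=.
  by have [[]] := Pprime.
have h1 : (0 < size h)%N by rewrite size_poly_gt0.
pose h' := h - lead_coef h *: 'X^((size h).-1).
have P0lX : P0X (lead_coef h *: 'X^((size h).-1)).
  move=> i; rewrite coefZ coefXn; have [[P00 _ _] _ _] := Pprime.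
  by case: eqP => _; rewrite ?mulr1// mulr0.
have Qh' : Q h' by apply: idealB => //; apply/PQ/P_P0X.
apply: nh => i; rewrite -(subrK (lead_coef h *: 'X^((size h).-1)) h) coefD /P0/=.
rewrite polyCD; have [[_ PD _] _ _] := Pprime; apply: PD; last exact: P0lX.
apply: hmin => //; rewrite -(prednK h1) ltnS; apply/leq_sizeP => j.
rewrite coefB coefZ coefXn leq_eqVlt eq_sym => /orP[/eqP ->|ltj].
  by rewrite eqxx mulr1 lead_coefE subrr.
rewrite (gtn_eqF ltj) mulr0 subr0; apply/leq_sizeP: ltj.
by rewrite prednK.
Qed.

Let reduce (Q : set {poly R}) h f : ideal Q -> Q h -> Q f ->
  (forall r, Q r -> (size r < size h)%N -> P0X r) -> h != 0 ->
  exists N q r, [/\ lead_coef h ^+ N *: f = q * h + r, P0X r &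
    (size q <= (size f).+1 - size h)%N].
Proof.
move=> Qid Qh Qf hmin h0; have [N [q [r [E szr szq]]]] := pseudo_division f h0.
exists N, q, r; split=> //; apply: hmin => //.
have -> : r = (lead_coef h ^+ N)%:P * f - q * h by rewrite mul_polyC E addrC addKr.
by have [_ _ QM] := Qid; apply: idealB => //; apply: QM.
Qed.

(* Modulo P either the indeterminate is transcendental over R, and almost any
   t will do, or it is algebraic and t is a root of the specialised minimal
   polynomial g; in the second case b has a multiple that is a nonzero
   constant modulo P. *)
Lemma prime_ideal_extend_point (k : closedFieldType) b : ~ P b ->
  exists2 a : R, ~ P a%:P & forall phi : {rmorphism R -> k},
    (forall r, P r%:P -> phi r = 0) -> phi a != 0 ->
    exists2 t : k, (forall f, P f -> (map_poly phi f).[t] = 0) &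
      (map_poly phi b).[t] != 0.
Proof.
move=> nPb; have [Pid P1 PM] := Pprime; have [PO PD PMl] := Pid.
case: (pselect (exists2 f, P f & ~ P0X f)) => [[f0 Pf0 nf0]|allP]; last first.
  have [i nPbi] : exists i, ~ P0 b`_i.
    apply: contrapT => H; apply/nPb/P_P0X => i; apply: contrapT => nb.
    by apply: H; exists i.
  exists b`_i => // phi phi0 phia.
  have /closed_nonrootP[t tP] : map_poly phi b != 0.
    by apply: contraNneq phia => E; rewrite -coef_map E coef0.
  exists t; last exact: tP.
  move=> f Pf; suff -> : map_poly phi f = 0 by rewrite horner0.
  apply/polyP => j; rewrite coef_map coef0; apply: phi0.
  by apply: contrapT => nf; apply: allP; exists f => // /(_ j).
have [g [Pg nc gmin]] := minimal_element Pid (@subset_refl _ P) Pf0 nf0.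
have lead0 h : ~ P0 (lead_coef h) -> h != 0.
  by apply: contra_notN => /eqP ->; rewrite lead_coef0.
have g0 := lead0 _ nc.
pose Q : set {poly R} := [set f | exists u, P (f - u * b)].
have Qid : ideal Q.
  split=> [|x y [u Pu] [v Pv]|r x [u Pu]].
  - by exists 0; rewrite mul0r subr0.
  - by exists (u + v); rewrite mulrDl opprD addrACA; apply: PD.
  - by exists (r * u); rewrite -mulrA -mulrBr; apply: PMl.
have PQ : P `<=` Q by move=> x Px; exists 0; rewrite mul0r subr0.
have Qb : Q b by exists 1; rewrite mul1r subrr.
have [h [Qh nd hmin]] := minimal_element Qid PQ (PQ _ Pg) (fun H => nc (H _)).
have h0 := lead0 _ nd.
have PXM c N f : ~ P0 c -> P (c ^+ N *: f) -> P f.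
  move=> ncc; rewrite -mul_polyC => /PM[]// PcN.
  by exfalso; apply/ncc/(prime_idealX Pprime (n := N)); rewrite -rmorphXn.
(* If h were not constant, dividing g by h would put q h in P. If q is in P, it is too small not to
   be in [P0X], and so the leading coefficient of g falls into [P0]; if h is in P, so is b. *)
have szh : (size h <= 1)%N.
  rewrite leqNgt; apply/negP => lt1h.
  have [N [q [r [E r0 szq]]]] := reduce Qid Qh (PQ _ Pg) hmin h0.
  have /PM[Pq|Ph] : P (q * h).
    rewrite -(addrK r (q * h)) -E; apply: idealB => //; last exact: P_P0X.
    by rewrite -mul_polyC; apply: PMl.
  - have q0 : P0X q.
      apply: gmin => //; rewrite (leq_ltn_trans szq)// ltn_subLR; last first.
        apply: leqW; rewrite leqNgt; apply/negP => ltgh.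
        by apply: nc; apply: hmin => //; apply: PQ.
      by rewrite -[X in (X < _)%N]add1n ltn_add2r.
    have : P0 (lead_coef h ^+ N *: g)`_(size g).-1.
      rewrite E coefD coefM /P0/= polyCD rmorph_sum; apply: PD; last exact: r0.
      by apply: ideal_sum => // i _ /=; rewrite polyCM mulrC; apply/PMl/q0.
    rewrite coefZ /P0/= polyCM => /PM[|//]; rewrite rmorphXn.
    by move=> /(prime_idealX Pprime).
  - have [M [q' [r' [E' r'0 _]]]] := reduce Qid Qh Qb hmin h0.
    apply: nPb; apply: (PXM (lead_coef h) M) => //; rewrite E'.
    by apply: PD; [apply: PMl|apply: P_P0X].
have hC : h = (lead_coef h)%:P.
  by rewrite [LHS](size1_polyC szh) lead_coefE; case: (size h) szh => [|[]].
(* Where this is nonzero, g keeps its positive degree and so has a root, while h stays a nonzero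
   constant and is a multiple of b modulo P. *)
exists (lead_coef g * lead_coef h).
  by rewrite polyCM => /PM[].
move=> phi phi0; rewrite rmorphM mulf_eq0 negb_or => /andP[c0 d0].
have szg : size (map_poly phi g) = size g.
  by apply: size_map_poly_id0.
have /closed_rootP[t /rootP tP] : size (map_poly phi g) != 1%N.
  rewrite szg; apply/eqP => sz1; apply: nc; rewrite /P0/= lead_coefE sz1.
  by rewrite -size1_polyC ?sz1.
have Pt f : P f -> (map_poly phi f).[t] = 0.
  move=> Pf; have [N [q [r [E r0 _]]]] := reduce Pid Pg Pf gmin g0.
  have r'0 : map_poly phi r = 0.
    by apply/polyP => i; rewrite coef_map coef0; apply: phi0; apply: r0.
  have := congr1 (fun x => (map_poly phi x).[t]) E.
  rewrite map_polyZ /= rmorphD rmorphM /= r'0 addr0 hornerZ hornerM tP mulr0.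
  by move/eqP; rewrite mulf_eq0 rmorphXn expf_eq0 (negPf c0) andbF => /eqP.
exists t => //; have [u Pu] := Qh.
apply: contra d0 => /eqP bt0; have := Pt _ Pu.
rewrite rmorphB rmorphM /= hornerD hornerN hornerM bt0 mulr0 subr0.
by rewrite [in map_poly _ h]hC map_polyC hornerC => ->.
Qed.

End PointsOfPrimeIdeals.

Lemma mpoly_alg_ind (R : comNzRingType) n (T : {mpoly R[n]} -> Prop) :
  (forall c, T c%:MP) -> (forall i, T 'X_i) ->
  (forall p q, T p -> T q -> T (p + q)) ->
  (forall p q, T p -> T q -> T (p * q)) -> forall p, T p.
Proof.
move=> TC TX TD TM p; elim/mpolyind: p => [|c m p _ _ Tp].
  by rewrite -mpolyC0.
apply: TD => //; rewrite -mul_mpolyC; apply: (TM) => //.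
rewrite mpolyXE_id; apply: (big_ind T); [by rewrite -mpolyC1|exact: TM|].
move=> i _; move: (m i) => l; elim: l => [|j IHj]; first by rewrite expr0 -mpolyC1.
by rewrite exprS; apply: TM.
Qed.

(** Induction on n: the prime ideal is contracted to one variable fewer, and a zero of the
    contraction where the auxiliary element [a] survives extends to a zero of P where b survives. *)
Lemma prime_ideal_point (k : closedFieldType) n (P : set {mpoly k[n]}) b :
  prime_ideal P -> ~ P b ->
  exists2 v : 'I_n -> k, (forall p, P p -> p.@[v] = 0) & b.@[v] != 0.
Proof.
elim: n P b => [|n IHn] P b Pprime nPb; have [[PO PD PM] P1 PMul] := Pprime.
  have constP (p : {mpoly k[0]}) : p = (p@_0)%:MP.
    by apply/mpolyP => m; rewrite mcoeffC; have -> : m = 0%MM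
      by [apply/mnmP => -[]]; rewrite eqxx mulr1.
  exists (fun=> 0) => [p Pp|]; last first.
    rewrite (constP b) mevalC; apply: contra_notN nPb => /eqP b0.
    by rewrite (constP b) b0.
  rewrite (constP p) mevalC; apply/eqP; apply: contra_notT P1 => p0.
  have -> : 1 = (p@_0)^-1%:MP * p by rewrite [X in _ * X]constP -mpolyCM mulVf.
  exact: PM.
have [f [fC fX fsurj]] := poly_mpoly_morphism k n.
pose Pf : set {poly {mpoly k[n]}} := [set q | P (f q)].
have Pfprime : prime_ideal Pf := prime_ideal_preim f Pprime.
have [b' b'b] := fsurj b.
have [|a nPa ext] := prime_ideal_extend_point Pfprime k (b := b').
  by rewrite -b'b in nPb.
pose P' : set {mpoly k[n]} := [set r | Pf r%:P].
have P'prime : prime_ideal P' := prime_ideal_preim (f \o polyC) Pprime.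
have [v vP va] := IHn P' a P'prime nPa.
have [t tP tb] := ext (meval v) vP va.
pose w i := if unlift ord_max i is Some j then v j else t.
have wE q : (f q).@[w] = (map_poly (meval v) q).[t].
  have mw p : (mwiden p).@[w] = p.@[v].
    elim/mpoly_alg_ind: p => [c|i|p q' Ep Eq|p q' Ep Eq].
    - by rewrite mwidenC !mevalC.
    - rewrite mwidenX mnmwiden1 !mevalXU /w.
      have -> : widen_ord (leqnSn n) i = lift ord_max i.
        by apply: val_inj; rewrite /= /bump leqNgt ltn_ord.
      by rewrite liftK.
    - by rewrite mwidenD !mevalD Ep Eq.
    - by rewrite mwidenM !mevalM Ep Eq.
  elim/poly_ind: q => [|q c IHq]; first by rewrite !rmorph0 horner0.
  rewrite !rmorphD !rmorphM /= fC fX map_polyX map_polyC !hornerE -IHq /= mw.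
  by rewrite mevalXU {2}/w unlift_none.
exists w => [p Pp|]; last by rewrite -b'b wE.
have [q qp] := fsurj p; rewrite -qp wE; apply: tP.
by rewrite -qp in Pp.
Qed.

Lemma field_noetherian (k : fieldType) : noetherian k.
Proof.
move=> u; have [u0|u0] := eqVneq (u 0%N) 0.
  by exists 0%N, (fun=> 0); rewrite big_ord0.
by exists 1%N, (fun=> u 1%N / u 0%N); rewrite big_ord1 divfK.
Qed.

(** An ideal containing I and maximal among those without a power of x is prime, so it has a zero at
    which x does not vanish. *)
Lemma nullstellensatz (k : closedFieldType) n (I : set {mpoly k[n]}) x :
  ideal I -> (forall v : 'I_n -> k, (forall p, I p -> p.@[v] = 0) -> x.@[v] = 0) ->
  exists N, I (x ^+ N).
Proof.
move=> Iid xI; apply: contrapT => noN.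
have noeth := noetherian_mpoly (n := n) (@field_noetherian k).
have [|M [Mid IM nM Mmax]] :=
  @noetherian_max_ideal _ (fun J => forall N, ~ J (x ^+ N)) I noeth Iid.
  by move=> N IxN; apply: noN; exists N.
have [MO MD MM] := Mid.
have add a : ~ M a -> exists N u, M (x ^+ N - u * a).
  move=> nMa; apply: contrapT => noM.
  pose M' : set {mpoly k[n]} := [set y | exists u, M (y - u * a)].
  apply: nMa; apply: (Mmax M').
  - split=> [|y z [u Mu] [v Mv]|r y [u Mu]].
    + by exists 0; rewrite mul0r subr0.
    + by exists (u + v); rewrite mulrDl opprD addrACA; apply: MD.
    + by exists (r * u); rewrite -mulrA -mulrBr; apply: MM.
  - by move=> y My; exists 0; rewrite mul0r subr0.
  - by move=> N [u Mu]; apply: noM; exists N, u.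
  - by exists 1; rewrite mul1r subrr.
have Mprime : prime_ideal M.
  split=> // [M1|a b Mab]; first by apply: (nM 0%N); rewrite expr0.
  apply: contrapT => /not_orP[/add[N [u Mu]] /add[N' [u' Mu']]].
  apply: (nM (N + N')%N); rewrite exprD.
  have -> : x ^+ N * x ^+ N' = (x ^+ N - u * a) * x ^+ N' +
      (u * a) * (x ^+ N' - u' * b) + (u * u') * (a * b).
    rewrite mulrBl mulrBr -!addrA (addrA (- _ ) (_ * _)) addNr add0r.
    by rewrite mulrACA addNr addr0.
  apply: (MD); last exact: (MM).
  by apply: (MD); [apply: idealMr|apply: (MM)].
have [|v vM vx] := prime_ideal_point (b := x) Mprime.
  by rewrite -[x]expr1; apply: nM.
by case/eqP: vx; apply: xI => p Ip; apply/vM/IM.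
Qed.

(** * Derivations tangent to a fibre *)

Section DerivationsConstantOnIdealGenerators.
Variables (R T : comNzRingType) (D : R -> R) (theta : {rmorphism T -> R}).
Hypothesis DD : forall a b, D (a + b) = D a + D b.
Hypothesis DM : forall a b, D (a * b) = D a * b + a * D b.

Let D0 : D 0 = 0.
Proof. by apply: (addrI (D 0)); rewrite -DD !addr0. Qed.

Let mulDX a n : a * D (a ^+ n) = n%:R * D a * a ^+ n.
Proof.
elim: n => [|n IHn].
  rewrite expr0 mul0r mul0r.
  suff -> : D 1 = 0 by rewrite mulr0.
  by apply: (addrI (D 1)); have := DM 1 1; rewrite !mulr1 mul1r addr0 => <-.
by rewrite exprS DM mulrDr (mulrCA a a) IHn; ring.
Qed.

(* Differentiate D z ^ 2i * P^(i)(z) and multiply by D z once more: as the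
   coefficients of P are constants, P^(i)(z) differentiates to
   P^(i+1)(z) * D z modulo K. *)
Lemma derivation_root_pow (K : set R) (P : {poly T}) z i :
  ideal K -> (forall a, K a -> K (D a)) -> (forall t, K (D (theta t))) ->
  K (map_poly theta P).[z] -> K (D z ^+ i.*2 * (map_poly theta P^`(i)).[z]).
Proof.
move=> Kid DK Dt KP; have [K0 KD KM] := Kid.
have Dpoly Q : K (D (map_poly theta Q).[z] - D z * (map_poly theta Q^`()).[z]).
  elim/poly_ind: Q => [|Q c IHQ].
    by rewrite deriv0 rmorph0 !horner0 mulr0 subr0 D0.
  rewrite derivD derivM derivX derivC addr0 mulr1.
  rewrite !rmorphD !rmorphM /= map_polyX map_polyC !hornerE DD DM.
  have -> : D (map_poly theta Q).[z] * z + (map_poly theta Q).[z] * D z +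
      D (theta c) - D z * ((map_poly theta Q^`()).[z] * z + (map_poly theta Q).[z]) =
      z * (D (map_poly theta Q).[z] - D z * (map_poly theta Q^`()).[z]) + D (theta c).
    by ring.
  by apply: KD => //; apply: KM.
elim: i => [|i IHi]; first by rewrite expr0 mul1r derivn0.
rewrite derivnS doubleS; set Q := P^`(i) in IHi *.
have -> : D z ^+ i.*2.+2 * (map_poly theta Q^`()).[z] =
    D z * D (D z ^+ i.*2 * (map_poly theta Q).[z]) -
    i.*2%:R * D (D z) * (D z ^+ i.*2 * (map_poly theta Q).[z]) -
    D z ^+ i.*2.+1 * (D (map_poly theta Q).[z] - D z * (map_poly theta Q^`()).[z]).
  by rewrite DM mulrDr mulrA mulDX !exprS; ring.
apply: idealB => //; last exact: KM.
by apply: idealB => //; apply: KM => //; apply: DK.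
Qed.

Variables (s : nat) (y : 'I_s -> R) (t : 'I_s -> T) (I : set R).
Hypotheses (Iid : ideal I) (DI : forall a, I a -> I (D a)).
Hypothesis Dtheta : forall c, I (D (theta c)).
Hypothesis thetaE : forall i, theta (t i) = y i.

(** Unlike a general derivation, D does not lower the order in y, since D y_i lies in I. *)
Let Dipow j a : ipow y j a -> ipow_mod y I j (D a).
Proof.
have Kid j' := ipow_mod_ideal y j' Iid.
elim=> {j a} [j|a|j i a ja [p jp Ip]|j a b _ IHa _ IHb].
- by rewrite D0; have [] := Kid j.
- exact/ipow_modW/ipow_top.
- rewrite DM; have [_ KD KM] := Kid j.+1; apply: KD.
    rewrite mulrC; apply/KM/ipow_mod_sub => //.
    by rewrite -thetaE; apply: Dtheta.
  exists (y i * p); first exact: ipow_gen.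
  by rewrite -mulrBr; have [_ _ IM] := Iid; apply: IM.
- by rewrite DD; have [_ KD _] := Kid j; apply: KD.
Qed.

Let Dipow_mod j a : ipow_mod y I j a -> ipow_mod y I j (D a).
Proof.
move=> [q jq Iq]; have [_ KD _] := ipow_mod_ideal y j Iid.
rewrite -(subrK q a) DD; apply: KD; last exact: Dipow.
exact/ipow_mod_sub/DI.
Qed.

Variables (m : nat) (w : 'I_m -> R).
Hypothesis span1 : forall f,
  exists c : 'I_m -> T, ipow_mod y I 1 (f - \sum_l theta (c l) * w l).

(** Successive approximation: the error in (y)^j is expanded again with coefficients of order j. The
    number m of generators does not grow with j, so the exponent in [derivation_pow_ipow] is
    uniform. *)
Let span j f :
  exists c : 'I_m -> T, ipow_mod y I j (f - \sum_l theta (c l) * w l).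
Proof.
have sumD (c d : 'I_m -> T) : \sum_l theta (c l + d l) * w l =
    \sum_l theta (c l) * w l + \sum_l theta (d l) * w l.
  by rewrite -big_split; apply: eq_bigr => l _; rewrite rmorphD mulrDl.
have sum0 : \sum_(l < m) theta 0 * w l = 0.
  by rewrite big1// => l _; rewrite rmorph0 mul0r.
have step i a : ipow y i a ->
    exists c : 'I_m -> T, ipow_mod y I i.+1 (a - \sum_l theta (c l) * w l).
  elim=> {i a} [i|a|i l a _ [c [q iq Iq]]|i a b _ [c Kc] _ [d Kd]].
  - exists (fun=> 0); rewrite sum0 subr0.
    by have [] := ipow_mod_ideal y i.+1 Iid.
  - exact: span1.
  - exists (fun j => t l * c j), (y l * q); first exact: ipow_gen.
    have -> : \sum_j theta (t l * c j) * w j = y l * \sum_j theta (c j) * w j.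
      by rewrite mulr_sumr; apply: eq_bigr => j' _; rewrite rmorphM thetaE mulrA.
    by rewrite -!mulrBr; have [_ _ IM] := Iid; apply: IM.
  - exists (fun l => c l + d l); rewrite sumD opprD addrACA.
    by have [_ KD _] := ipow_mod_ideal y i.+1 Iid; apply: KD.
elim: j f => [|j IHj] f.
  by exists (fun=> 0); apply/ipow_modW/ipow_top.
have [c [q /step[d Kd] Iq]] := IHj f.
exists (fun l => c l + d l); rewrite sumD opprD addrA.
rewrite -(subrK q (f - _)) -addrA.
have [_ KD _] := ipow_mod_ideal y j.+1 Iid; apply: KD => //.
exact: ipow_mod_sub.
Qed.

(* Multiplication by z on the span of w modulo I + (y)^j is given by a matrix
   with constant coefficients, so z is a root of its characteristic
   polynomial modulo I + (y)^j. *)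
Lemma derivation_pow_ipow z l0 j : w l0 = 1 ->
  ipow_mod y I j (D z ^+ m.*2 * m`!%:R).
Proof.
move=> w1; have Kid := ipow_mod_ideal y j Iid; have [K0 KD KM] := Kid.
pose c i := sval (cid (span j (z * w i))).
have cP i : ipow_mod y I j (z * w i - \sum_l theta (c i l) * w l).
  by rewrite /c; case: cid.
pose C := \matrix_(i < m, l < m) c i l.
pose A := z%:M - map_mx theta C.
have AE i l : A i l = z *+ (i == l) - theta (c i l) by rewrite !mxE.
have Kdet : ipow_mod y I j (\det A).
  (* Cramer's rule: A kills the vector w modulo the ideal, hence so does det A, and one entry of w
     is 1. *)
  have -> : \det A = \sum_l (\adj A *m A) l0 l * w l.
    rewrite mul_adj_mx (bigD1 l0)//= mxE eqxx mulr1n w1 mulr1 big1 ?addr0//.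
    by move=> l nl; rewrite mxE eq_sym (negPf nl) mulr0n mul0r.
  have -> : \sum_l (\adj A *m A) l0 l * w l =
      \sum_i \adj A l0 i * (z * w i - \sum_l theta (c i l) * w l).
    under eq_bigr do rewrite mxE mulr_suml.
    rewrite exchange_big; apply: eq_bigr => i _ /=.
    under eq_bigr do rewrite -mulrA.
    rewrite -mulr_sumr; congr (_ * _).
    rewrite (eq_bigr (fun l => z *+ (i == l) * w l - theta (c i l) * w l)).
      rewrite sumrB; congr (_ - _); rewrite (bigD1 i)//= eqxx mulr1n big1 ?addr0//.
      by move=> l nl; rewrite eq_sym (negPf nl) mulr0n mul0r.
    by move=> l _; rewrite AE mulrBl.
  by apply: ideal_sum => // i _; apply/KM/cP.
have detE : (map_poly theta (char_poly C)).[z] = \det A.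
  rewrite map_char_poly -horner_evalE -det_map_mx; congr (\det _).
  apply/matrixP => i l; rewrite !mxE /= /horner_eval hornerD hornerN hornerC.
  by case: eqP => _; rewrite ?hornerX ?horner0.
rewrite -detE in Kdet.
have := @derivation_root_pow (ipow_mod y I j) (char_poly C) z m Kid
  (fun a => @Dipow_mod j a) (fun c => ipow_mod_sub _ _ Iid (Dtheta c)) Kdet.
suff -> : (char_poly C)^`(m) = m`!%:R%:P.
  by rewrite map_polyC hornerC /= rmorph_nat.
apply/polyP => i; rewrite coef_derivn coefC; case: i => [|i].
  rewrite addn0 ffactnn; have /monicP := char_poly_monic C.
  by rewrite lead_coefE size_char_poly /= => ->.
by rewrite nth_default ?mul0rn// size_char_poly addnS ltnS leq_addr.
Qed.

End DerivationsConstantOnIdealGenerators.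

(** * Extending a kernel vector to a polynomial family *)

Section GenericKernel.
Variables (S : comNzRingType) (k : fieldType) (cst : {rmorphism k -> S}).
Variables (T : Type) (ev : T -> {rmorphism S -> k}).
Hypothesis ev_cst : forall t c, ev t (cst c) = c.

(* With F L(x0) G = 1 of size r, the rank of L(x0), the identity
   d L = L G adj(F L G) F L, where d = det(F L G), holds wherever L has rank
   at most r and d is nonzero. *)
Lemma generic_kernel_vector d s (L : 'M[S]_(d, s)) (O : set T) x0
    (u0 : 'rV[k]_d) :
  (forall x, O x -> (\rank (map_mx (ev x) L) <= \rank (map_mx (ev x0) L))%N) ->
  u0 *m map_mx (ev x0) L = 0 ->
  exists2 u : 'rV[S]_d, map_mx (ev x0) u = u0 &
    forall x, O x -> map_mx (ev x) (u *m L) = 0.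
Proof.
set A := map_mx (ev x0) L => rk u0A.
pose F := pinvmx (col_base A); pose G := pinvmx (row_base A).
have FAG : F *m A *m G = 1%:M.
  rewrite -[X in F *m X]mulmx_base mulmxA mulVpmx ?col_base_full// mul1mx.
  by rewrite mulmxVp ?row_base_free.
pose Fc := map_mx cst F; pose Gc := map_mx cst G.
have ev_mx x a b (X : 'M[k]_(a, b)) : map_mx (ev x) (map_mx cst X) = X.
  by apply/matrixP => i j; rewrite !mxE ev_cst.
pose M := Fc *m L *m Gc.
(* The difference annihilates [L] where det M is nonzero; the factor in front takes care of the
   points where det M is zero. *)
pose u := \det M *: (\det M *: map_mx cst u0 -
  map_mx cst u0 *m L *m Gc *m \adj M *m Fc).
have evM x : map_mx (ev x) M = F *m map_mx (ev x) L *m G.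
  by rewrite !map_mxM !ev_mx.
have evu x : map_mx (ev x) u = \det (map_mx (ev x) M) *:
    (\det (map_mx (ev x) M) *: u0 -
     u0 *m map_mx (ev x) L *m G *m \adj (map_mx (ev x) M) *m F).
  by rewrite map_mxZ map_mxB map_mxZ -!det_map_mx !map_mxM map_mx_adj evM !ev_mx.
exists u => [|x Ox].
  by rewrite evu evM -/A FAG det1 !scale1r u0A !mul0mx subr0.
rewrite map_mxM evu evM; set B := map_mx (ev x) L; set N := F *m B *m G.
have [->|dN0] := eqVneq (\det N) 0; first by rewrite scale0r mul0mx.
have Nu : N \in unitmx by rewrite unitmxE unitfE.
(* Invertibility of N gives F B rank at least r, while B has rank at most r. *)
have /submxP[Y BE] : (B <= F *m B)%MS.
  rewrite -(mxrank_leqif_sup (submxMl F B)) eqn_leq mxrankS ?submxMl//=.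
  apply: leq_trans (rk _ Ox) _; rewrite -/A.
  by have := mxrankM_maxl (F *m B) G; rewrite -/N mxrank_unit.
have BG : B *m G = Y *m N by rewrite /N {1}BE !mulmxA.
rewrite -scalemxAl mulmxBl -scalemxAl; apply/eqP; rewrite scaler_eq0; apply/orP; right.
have -> : u0 *m B *m G *m \adj N *m F *m B =
    u0 *m (Y *m (N *m \adj N) *m (F *m B)) by rewrite (mulmxA Y) -BG !mulmxA.
by rewrite mul_mx_adj mul_mx_scalar -scalemxAl -BE -scalemxAr subrr.
Qed.

End GenericKernel.

(* Locked, since conversion between unfolded instances diverges. *)
HB.lock Definition vfield (k : fieldType) (n : nat)
    (B : 'M[{mpoly k[n * n]}]_n) (p : {mpoly k[n * n]}) : {mpoly k[n * n]} :=
  \sum_i mxvec B 0 i * p^`M(i).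

(** * Differential calculus on matrices *)

Lemma mderivXU (R : comNzRingType) n (i l : 'I_n) :
  ('X_l : {mpoly R[n]})^`M(i) = (l == i)%:R.
Proof.
rewrite mderivX mnm1E; have [->|_] := eqVneq l i; last by rewrite scale0r.
have -> : (U_(i) - U_(i))%MM = 0%MM :> 'X_{1..n}.
  by apply/mnmP => j; rewrite mnmBE subnn mnm0E.
by rewrite mpolyX0 scale1r.
Qed.

Section PolynomialFunctionsOnMatrices.
Variables (k : fieldType) (n : nat).
Local Notation S := {mpoly k[n * n]}.
Implicit Types (p q : S) (A B V X Y : 'M[k]_n).

Lemma mxevalC c A : mxeval (c%:MP : S) A = c.
Proof. exact: mevalC. Qed.

Lemma mxevalX i A : mxeval ('X_i : S) A = mxvec A 0 i.
Proof. exact: mevalXU. Qed.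

Lemma mxevalD p q A : mxeval (p + q) A = mxeval p A + mxeval q A.
Proof. exact: mevalD. Qed.

Lemma mxevalB p q A : mxeval (p - q) A = mxeval p A - mxeval q A.
Proof. exact: mevalB. Qed.

Lemma mxevalM p q A : mxeval (p * q) A = mxeval p A * mxeval q A.
Proof. exact: mevalM. Qed.

Lemma mxevalXn p A m : mxeval (p ^+ m) A = mxeval p A ^+ m.
Proof. exact: rmorphXn. Qed.

Lemma mxdiffC c A V : mxdiff (c%:MP : S) A V = 0.
Proof. by rewrite /mxdiff big1// => i _; rewrite mderivC meval0 mul0r. Qed.

Lemma mxdiffX i A V : mxdiff ('X_i : S) A V = mxvec V 0 i.
Proof.
rewrite /mxdiff (bigD1 i)//= big1 => [|j nji].
  by rewrite mderivXU eqxx meval1 mul1r addr0.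
by rewrite mderivXU eq_sym (negPf nji) meval0 mul0r.
Qed.

Lemma mxdiffD p q A V : mxdiff (p + q) A V = mxdiff p A V + mxdiff q A V.
Proof.
by rewrite -big_split; apply: eq_bigr => i _; rewrite mderivD mevalD mulrDl.
Qed.

Lemma mxdiffM p q A V :
  mxdiff (p * q) A V = mxdiff p A V * mxeval q A + mxeval p A * mxdiff q A V.
Proof.
rewrite /mxdiff mulr_suml mulr_sumr -big_split; apply: eq_bigr => i _ /=.
by rewrite mderivM mevalD !mevalM /mxeval; ring.
Qed.

Lemma mxdiffB p q A V : mxdiff (p - q) A V = mxdiff p A V - mxdiff q A V.
Proof.
rewrite -mulN1r -mpolyC1 -mpolyCN mxdiffD mxdiffM mxdiffC mul0r add0r mxevalC.
by rewrite mulN1r.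
Qed.

Lemma mxdiff_lin p A c V W :
  mxdiff p A (c *: V + W) = c * mxdiff p A V + mxdiff p A W.
Proof.
rewrite /mxdiff mulr_sumr -big_split; apply: eq_bigr => i _ /=.
by rewrite linearP !mxE; ring.
Qed.

Definition evmx A (a b : nat) (B : 'M[S]_(a, b)) : 'M[k]_(a, b) :=
  map_mx (meval (mxvec A 0)) B.

Definition dmx A V (a b : nat) (B : 'M[S]_(a, b)) : 'M[k]_(a, b) :=
  map_mx (fun P => mxdiff P A V) B.

Lemma dmxM A V (a b c : nat) (B : 'M[S]_(a, b)) (C : 'M[S]_(b, c)) :
  dmx A V (B *m C) = dmx A V B *m evmx A C + evmx A B *m dmx A V C.
Proof.
apply/matrixP => i j; rewrite !mxE -big_split /=.
apply: (big_rec2 (fun P y => mxdiff P A V = y)) => [|l y P _ <-].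
  by rewrite -mpolyC0 mxdiffC.
by rewrite mxdiffD mxdiffM !mxE.
Qed.

Lemma evmxM A (a b c : nat) (B : 'M[S]_(a, b)) (C : 'M[S]_(b, c)) :
  evmx A (B *m C) = evmx A B *m evmx A C.
Proof. exact: map_mxM. Qed.

Definition cmx (a b : nat) (B : 'M[k]_(a, b)) : 'M[S]_(a, b) := map_mx (@mpolyC _ k) B.

Lemma evmx_cmx A (a b : nat) (B : 'M[k]_(a, b)) : evmx A (cmx B) = B.
Proof. by apply/matrixP => i j; rewrite !mxE mevalC. Qed.

Lemma dmx_cmx A V (a b : nat) (B : 'M[k]_(a, b)) : dmx A V (cmx B) = 0.
Proof. by apply/matrixP => i j; rewrite !mxE mxdiffC. Qed.

Lemma mxvec_cmx V i : mxvec (cmx V) 0 i = (mxvec V 0 i)%:MP.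
Proof. by rewrite /cmx -map_mxvec mxE. Qed.

Definition generic_mx : 'M[S]_n := \matrix_(i, j) 'X_(mxvec_index i j).
Local Notation gx := generic_mx.

Lemma evmx_generic A : evmx A gx = A.
Proof. by apply/matrixP => i j; rewrite !mxE mevalXU mxvecE. Qed.

Lemma dmx_generic A V : dmx A V gx = V.
Proof. by apply/matrixP => i j; rewrite !mxE mxdiffX mxvecE. Qed.

Lemma mxeval_det A : mxeval (\det gx) A = \det A.
Proof. by rewrite /mxeval -det_map_mx -/(evmx A gx) evmx_generic. Qed.

Definition mxsubst (B : 'M[S]_n) p : S := mmap (@mpolyC _ k) (mxvec B 0) p.

Lemma mxsubstC (B : 'M[S]_n) c : mxsubst B c%:MP = c%:MP.
Proof. exact: mmapC. Qed.

Lemma mxsubstX (B : 'M[S]_n) i : mxsubst B 'X_i = mxvec B 0 i.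
Proof. by rewrite /mxsubst mmapX mmap1U. Qed.

Lemma mxsubstD (B : 'M[S]_n) p q : mxsubst B (p + q) = mxsubst B p + mxsubst B q.
Proof. exact: rmorphD. Qed.

Lemma mxsubstM (B : 'M[S]_n) p q : mxsubst B (p * q) = mxsubst B p * mxsubst B q.
Proof. exact: rmorphM. Qed.

Lemma mxeval_subst (B : 'M[S]_n) p A : mxeval (mxsubst B p) A = mxeval p (evmx A B).
Proof.
elim/mpoly_alg_ind: p => [c|i|p q Ep Eq|p q Ep Eq].
- by rewrite mxsubstC !mxevalC.
- by rewrite mxsubstX mxevalX /evmx -map_mxvec mxE.
- by rewrite mxsubstD !mxevalD Ep Eq.
- by rewrite mxsubstM !mxevalM Ep Eq.
Qed.

Lemma mxdiff_subst (B : 'M[S]_n) p A V :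
  mxdiff (mxsubst B p) A V = mxdiff p (evmx A B) (dmx A V B).
Proof.
elim/mpoly_alg_ind: p => [c|i|p q Ep Eq|p q Ep Eq].
- by rewrite mxsubstC !mxdiffC.
- by rewrite mxsubstX mxdiffX /dmx -map_mxvec mxE.
- by rewrite mxsubstD !mxdiffD Ep Eq.
- by rewrite mxsubstM !mxdiffM Ep Eq !mxeval_subst.
Qed.

Definition translate A B : S -> S := mxsubst (cmx A *m gx *m cmx B).

Lemma mxeval_translate A B p X : mxeval (translate A B p) X = mxeval p (A *m X *m B).
Proof. by rewrite mxeval_subst !evmxM !evmx_cmx evmx_generic. Qed.

Lemma mxdiff_translate A B p X V :
  mxdiff (translate A B p) X V = mxdiff p (A *m X *m B) (A *m V *m B).
Proof.
rewrite mxdiff_subst !dmxM !evmxM !dmx_cmx !evmx_cmx evmx_generic dmx_generic.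
by rewrite mul0mx add0r mulmx0 addr0.
Qed.

Lemma mxeval_vfield (B : 'M[S]_n) p A : mxeval (vfield B p) A = mxdiff p A (evmx A B).
Proof.
rewrite /mxeval vfield.unlock rmorph_sum; apply: eq_bigr => i _.
by rewrite rmorphM /= mulrC /evmx -map_mxvec mxE.
Qed.

Lemma vfieldD (B : 'M[S]_n) p q : vfield B (p + q) = vfield B p + vfield B q.
Proof.
rewrite vfield.unlock -big_split; apply: eq_bigr => i _.
by rewrite mderivD mulrDr.
Qed.

Lemma vfieldM (B : 'M[S]_n) p q : vfield B (p * q) = vfield B p * q + p * vfield B q.
Proof.
rewrite vfield.unlock mulr_suml mulr_sumr -big_split; apply: eq_bigr => i _ /=.
by rewrite mderivM; ring.
Qed.

Lemma vfieldC (B : 'M[S]_n) c : vfield B c%:MP = 0.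
Proof. by rewrite vfield.unlock big1// => i _; rewrite mderivC mulr0. Qed.

Lemma vfieldX (B : 'M[S]_n) i : vfield B 'X_i = mxvec B 0 i.
Proof.
rewrite vfield.unlock (bigD1 i)//= big1 => [|j nji].
  by rewrite mderivXU eqxx mulr1 addr0.
by rewrite mderivXU eq_sym (negPf nji) mulr0.
Qed.

Definition linform (l : 'M[k]_n -> k) : S :=
  \sum_i (l (vec_mx (delta_mx 0 i)))%:MP * 'X_i.

Section LinearForm.
Variable l : 'M[k]_n -> k.
Hypothesis lin_l : forall c X Y, l (c *: X + Y) = c * l X + l Y.

Lemma linform0 : l 0 = 0.
Proof. by apply: (addrI (l 0)); rewrite -{1}[l 0]mul1r -lin_l scaler0 !addr0. Qed.

Lemma linform_sum (I : finType) (c : I -> k) (F : I -> 'M[k]_n) :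
  l (\sum_i c i *: F i) = \sum_i c i * l (F i).
Proof.
apply: (big_rec2 (fun V y => l V = y)) => [|i y V _ <-].
  exact: linform0.
exact: lin_l.
Qed.

Let linformE A : l A = \sum_i l (vec_mx (delta_mx 0 i)) * mxvec A 0 i.
Proof.
rewrite -{1}[A]mxvecK {1}[mxvec A]row_sum_delta linear_sum.
under eq_bigr do rewrite linearZ.
by rewrite linform_sum; apply: eq_bigr => i _; rewrite mulrC.
Qed.

Lemma mxeval_linform A : mxeval (linform l) A = l A.
Proof.
rewrite linformE /mxeval rmorph_sum; apply: eq_bigr => i _.
by rewrite rmorphM /= mevalC mevalXU.
Qed.

Lemma mxdiff_linform A V : mxdiff (linform l) A V = l V.
Proof.
rewrite linformE.
apply: (big_rec2 (fun P y => mxdiff P A V = y)) => [|i y P _ <-].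
  by rewrite -mpolyC0 mxdiffC.
by rewrite mxdiffD mxdiffM mxdiffC mul0r add0r mxevalC mxdiffX.
Qed.

End LinearForm.

Definition det_diff X : k := mxdiff (\det gx) 1%:M X.
Local Notation tau := det_diff.

(** Differentiate det(x A) = det x det A at x = 1. *)
Lemma mxdiff_det A X : mxdiff (\det gx) A (X *m A) = tau X * \det A.
Proof.
have E : translate 1%:M A (\det gx) = \det gx * (\det A)%:MP.
  rewrite /translate /mxsubst -det_map_mx.
  have -> : map_mx (mmap (@mpolyC _ k) (mxvec (cmx 1%:M *m gx *m cmx A) 0)) gx =
      gx *m cmx A.
    apply/matrixP => i j; rewrite mxE mxE mmapX mmap1U mxvecE.
    by rewrite /cmx map_mx1 mul1mx.
  by rewrite det_mulmx det_map_mx.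
have := mxdiff_translate 1%:M A (\det gx) 1%:M X.
by rewrite !mul1mx => <-; rewrite E mxdiffM mxdiffC mxevalC mulr0 addr0.
Qed.

Lemma mxdiff_detX A X d :
  mxdiff (\det gx ^+ d) A (X *m A) = d%:R * tau X * \det A ^+ d.
Proof.
elim: d => [|d IHd]; first by rewrite expr0 -mpolyC1 mxdiffC !mul0r.
by rewrite exprS mxdiffM IHd mxdiff_det mxevalXn mxeval_det exprS; ring.
Qed.

(** Differentiate adj(a) a = det(a) along X a and cancel A. *)
Lemma dmx_adj A X : A \in unitmx ->
  dmx A (X *m A) (\adj gx) = tau X *: \adj A - \adj A *m X.
Proof.
move=> Au; have eadj : evmx A (\adj gx) = \adj A.
  by rewrite /evmx map_mx_adj -/(evmx A gx) evmx_generic.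
have := dmxM A (X *m A) (\adj gx) gx.
rewrite mul_adj_mx evmx_generic dmx_generic eadj => E.
rewrite -[LHS](mulmxK Au); apply: (canLR (mulmxK Au)); rewrite mulmxBl.
apply/eqP; rewrite eq_sym subr_eq -mulmxA -E -scalemxAl mul_adj_mx.
apply/eqP/matrixP => i j; rewrite !mxE.
have [_|_] := eqVneq i j; first by rewrite !mulr1n mxdiff_det.
by rewrite !mulr0n mulr0 -mpolyC0 mxdiffC.
Qed.

(* det ^ d clears the denominators of the matrix coefficients of the inverse
   of a in p(a Y a^-1). *)
Lemma orbit_map_polynomial p Y : exists d (P : S), forall a, a \in unitmx ->
  mxeval P a = \det a ^+ d * mxeval p (Ad a Y) /\
  forall X, mxdiff P a (X *m a) = \det a ^+ d *
    (d%:R * tau X * mxeval p (Ad a Y) + mxdiff p (Ad a Y) (lie_bracket X (Ad a Y))).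
Proof.
elim/mpoly_alg_ind: p => [c|i|p q [d [P EP]] [e [Q EQ]]|p q [d [P EP]] [e [Q EQ]]].
- exists 0%N, c%:MP => a _; rewrite expr0 !mxevalC mul1r; split=> // X.
  by rewrite !mxdiffC !mul0r addr0 mulr0.
- case/mxvec_indexP: i => i j; exists 1%N, ((gx *m cmx Y *m \adj gx) i j) => a au.
  have eadj : \adj a = \det a *: invmx a.
    by rewrite /invmx au scalerA divff ?scale1r// -unitfE -unitmxE.
  have evadj : evmx a (\adj gx) = \adj a.
    by rewrite /evmx map_mx_adj -/(evmx a gx) evmx_generic.
  split=> [|X].
    transitivity ((evmx a (gx *m cmx Y *m \adj gx)) i j); first by rewrite [RHS]mxE.
    rewrite !evmxM evmx_generic evmx_cmx evadj eadj -scalemxAr mxE expr1.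
    by rewrite mxevalX mxvecE.
  transitivity ((dmx a (X *m a) (gx *m cmx Y *m \adj gx)) i j); first by rewrite [RHS]mxE.
  rewrite !dmxM dmx_generic dmx_cmx mulmx0 addr0 evmxM evmx_cmx evmx_generic.
  rewrite dmx_adj// evadj eadj expr1 mul1r mxevalX mxdiffX !mxvecE.
  rewrite -scalemxAl mulmxBr -!scalemxAr.
  rewrite -[X *m a *m Y *m invmx a]mulmxA -[X *m a *m _]mulmxA [a *m (Y *m _)]mulmxA.
  rewrite [a *m Y *m (invmx a *m X)]mulmxA -/(Ad a Y) /lie_bracket !mxE.
  by ring.
- exists (d + e)%N, (P * \det gx ^+ e + Q * \det gx ^+ d) => a au.
  have [[P0 P1] [Q0 Q1]] := (EP a au, EQ a au); split=> [|X].
    by rewrite !mxevalD !mxevalM !mxevalXn mxeval_det P0 Q0 exprD; ring.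
  rewrite !mxdiffD !mxdiffM P1 Q1 !mxdiff_detX !mxevalXn mxeval_det P0 Q0 !mxevalD.
  by rewrite exprD natrD; ring.
- exists (d + e)%N, (P * Q) => a au.
  have [[P0 P1] [Q0 Q1]] := (EP a au, EQ a au); split=> [|X].
    by rewrite !mxevalM P0 Q0 exprD; ring.
  by rewrite !mxdiffM P1 Q1 P0 Q0 !mxevalM exprD natrD; ring.
Qed.

End PolynomialFunctionsOnMatrices.
Arguments cmx {k n a b} B.

(** * The identity principle on a connected group *)

Section TaylorExpansion.
Variables (k : fieldType) (n : nat) (b : 'M[k]_n).
Local Notation S := {mpoly k[n * n]}.
Implicit Types (p q : S).

Definition coordinate_at i : S := 'X_i - (mxvec b 0 i)%:MP.
Local Notation y := coordinate_at.

Lemma mxeval_ipow j p : ipow y j.+1 p -> mxeval p b = 0.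
Proof.
apply: (@ipow_rmorph0 _ _ _ _ (meval (mxvec b 0))) => i.
by rewrite /= mevalB mevalXU mevalC subrr.
Qed.

Definition linear_part p : S := \sum_i (p^`M(i).@[mxvec b 0])%:MP * y i.

Lemma taylor2 p : ipow y 2 (p - (mxeval p b)%:MP - linear_part p).
Proof.
have y1 i : ipow y 1 (y i) by exact: ipow1_gen.
have yl p' : ipow y 1 (linear_part p').
  by apply: ideal_sum (ipow_ideal _ _) _ => i _; apply: ipow_Ml.
have [_ yD yM] := ipow_ideal y 2.
elim/mpoly_alg_ind: p => [c|i|p q Ep Eq|p q Ep Eq].
- rewrite mxevalC subrr sub0r /linear_part big1 ?oppr0; first exact: ipow_0.
  by move=> i _; rewrite mderivC meval0 mpolyC0 mul0r.
- suff -> : 'X_i - (mxeval 'X_i b)%:MP - linear_part 'X_i = 0 by exact: ipow_0.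
  rewrite mxevalX; apply/eqP; rewrite subr_eq0; apply/eqP.
  rewrite /linear_part (bigD1 i)//= big1 => [|j nji].
    by rewrite mderivXU eqxx meval1 mpolyC1 mul1r addr0.
  by rewrite mderivXU eq_sym (negPf nji) meval0 mpolyC0 mul0r.
- have -> : linear_part (p + q) = linear_part p + linear_part q.
    rewrite -big_split; apply: eq_bigr => i _.
    by rewrite mderivD mevalD mpolyCD mulrDl.
  rewrite mxevalD mpolyCD.
  have -> : p + q - ((mxeval p b)%:MP + (mxeval q b)%:MP) -
      (linear_part p + linear_part q) = (p - (mxeval p b)%:MP - linear_part p) +
      (q - (mxeval q b)%:MP - linear_part q) by ring.
  exact: yD.
- have -> : linear_part (p * q) =
      (mxeval q b)%:MP * linear_part p + (mxeval p b)%:MP * linear_part q.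
    rewrite /linear_part !mulr_sumr -big_split; apply: eq_bigr => i _ /=.
    by rewrite mderivM mevalD !mevalM mpolyCD !mpolyCM /mxeval; ring.
  rewrite mxevalM mpolyCM.
  have -> : p * q - (mxeval p b)%:MP * (mxeval q b)%:MP -
      ((mxeval q b)%:MP * linear_part p + (mxeval p b)%:MP * linear_part q) =
      q * (p - (mxeval p b)%:MP - linear_part p) +
      (mxeval p b)%:MP * (q - (mxeval q b)%:MP - linear_part q) +
      linear_part p * (q - (mxeval q b)%:MP - linear_part q) +
      linear_part p * linear_part q by ring.
  apply: (yD); last by apply: (@ipow_M _ _ _ 1 1).
  by apply: (yD); [apply: (yD)|]; apply: yM.
Qed.

Lemma taylor1 p : ipow y 1 (p - (mxeval p b)%:MP).
Proof.
rewrite -(subrK (linear_part p) (p - _)); have [_ yD _] := ipow_ideal y 1.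
apply: yD; first exact/ipow_leS/taylor2.
by apply: ideal_sum (ipow_ideal _ _) _ => i _; apply/ipow_Ml/ipow1_gen.
Qed.

Lemma mderiv_coordinate_at i l : (y l)^`M(i) = (i == l)%:R.
Proof.
by rewrite mderivB mderivC subr0 mderivXU eq_sym.
Qed.

Lemma ipow_mderiv j i p : ipow y j.+1 p -> ipow y j p^`M(i).
Proof.
move Ej: j.+1 => l lp; elim: lp j Ej => {l p} [l|//|l r p lp IHp|l p q _ IHp _ IHq] j Ej.
- by rewrite mderiv0; apply: ipow_0.
- case: Ej => El; subst l; rewrite mderivM mderiv_coordinate_at; apply: ipow_D.
    exact: ipow_Ml.
  case: j lp IHp => [|j] lp IHp; first exact: ipow_top.
  by apply: ipow_gen; apply: IHp.
- by rewrite mderivD; apply: ipow_D; [apply: IHp|apply: IHq].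
Qed.

Lemma ipow_euler j p : ipow y j p -> ipow y j.+1 (\sum_i y i * p^`M(i) - j%:R * p).
Proof.
elim=> {j p} [j|p|j l p jp IHp|j p q _ IHp _ IHq].
- rewrite mulr0 subr0 big1; first exact: ipow_0.
  by move=> i _; rewrite mderiv0 mulr0.
- rewrite mul0r subr0; apply: ideal_sum (ipow_ideal _ _) _ => i _.
  by rewrite mulrC; apply/ipow_Ml/ipow1_gen.
- have -> : \sum_i y i * (y l * p)^`M(i) - j.+1%:R * (y l * p) =
      y l * (\sum_i y i * p^`M(i) - j%:R * p).
    under eq_bigr do rewrite mderivM mderiv_coordinate_at mulrDr.
    rewrite big_split /=.
    have -> : \sum_i y i * ((i == l)%:R * p) = y l * p.
      rewrite (bigD1 l)//= eqxx mul1r big1 ?addr0// => i /negPf ->.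
      by rewrite mul0r mulr0.
    have -> : \sum_i y i * (y l * p^`M(i)) = y l * \sum_i y i * p^`M(i).
      by rewrite mulr_sumr; apply: eq_bigr => i _; rewrite mulrCA.
    by ring.
  exact: ipow_gen.
- have -> : \sum_i y i * (p + q)^`M(i) - j%:R * (p + q) =
      (\sum_i y i * p^`M(i) - j%:R * p) + (\sum_i y i * q^`M(i) - j%:R * q).
    under eq_bigr do rewrite mderivD mulrDr.
    by rewrite big_split /=; ring.
  exact: ipow_D.
Qed.

End TaylorExpansion.

Section LinearDuality.
Variables (k : fieldType) (N : nat).

Lemma double_annihilator (D : set 'rV[k]_N) (c : 'rV[k]_N) :
  D 0 -> (forall a u v, D u -> D v -> D (a *: u + v)) ->
  (forall v : 'cV[k]_N, (forall d, D d -> d *m v = 0) -> c *m v = 0) -> D c.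
Proof.
move=> D0 Dlin cD; pose U := vspace_of D.
have UP d : d \in U <-> D d by exact: mem_vspace_of.
pose B := \matrix_(i < \dim U) (vbasis U)`_i.
have /submxP[Y cE] : (c <= B)%MS.
  rewrite submxE; apply/eqP/matrixP => i j; rewrite ord1 [RHS]mxE.
  have -> : (c *m cokermx B) 0 j = (c *m col j (cokermx B)) 0 0.
    by rewrite colE mulmxA -colE [RHS]mxE.
  rewrite cD ?mxE// => d /UP dU; rewrite (coord_vbasis dU) mulmx_suml big1// => l _.
  have -> : (vbasis U)`_l = row l B by rewrite rowK.
  by rewrite -scalemxAl colE mulmxA -row_mul mulmx_coker linear0 mul0mx scaler0.
apply/UP; rewrite cE mulmx_sum_row; apply: memv_suml => i _; apply: memvZ.
by rewrite rowK vbasis_mem// mem_nth// size_tuple.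
Qed.

End LinearDuality.

Lemma commutator_Leibniz (R : comNzRingType) (d e : R -> R) a b :
  (forall x y, d (x + y) = d x + d y) -> (forall x y, e (x + y) = e x + e y) ->
  (forall x y, d (x * y) = d x * y + x * d y) ->
  (forall x y, e (x * y) = e x * y + x * e y) ->
  e (d (a * b)) - d (e (a * b)) = (e (d a) - d (e a)) * b + a * (e (d b) - d (e b)).
Proof. by move=> dD eD dM eM; rewrite dM eM dD eD !dM !eM; ring. Qed.

(** * Right invariant fields and the Lie algebra of a closed subgroup *)

Section LieAlgebraOfGroup.
Variables (k : fieldType) (n : nat).
Local Notation S := {mpoly k[n * n]}.
Local Notation gx := (generic_mx k n).
Implicit Types (p q P Q : S) (a X Y : 'M[k]_n) (G : set 'M[k]_n).

Lemma vanishing_ideal_ideal (Z : set 'M[k]_n) : ideal (vanishing_ideal Z).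
Proof.
split=> [A _|p q Ip Iq A ZA|r p Ip A ZA].
- by rewrite -mpolyC0 mxevalC.
- by rewrite mxevalD Ip// Iq// addr0.
- by rewrite mxevalM Ip// mulr0.
Qed.

Lemma zero_set_closed (E : set S) :
  zariski_closed [set A | forall p, E p -> mxeval p A = 0].
Proof.
apply/seteqP; split=> A /=; last by move=> ZA p; apply.
by move=> clA p Ep; apply: clA => B; apply.
Qed.

(* The right invariant vector field a |-> X a. *)
Definition rfield X p : S := vfield (cmx X *m gx) p.

Lemma mxeval_rfield X p a : mxeval (rfield X p) a = mxdiff p a (X *m a).
Proof. by rewrite mxeval_vfield evmxM evmx_cmx evmx_generic. Qed.

Lemma rfieldD X p q : rfield X (p + q) = rfield X p + rfield X q.
Proof. exact: vfieldD. Qed.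

Lemma rfieldM X p q : rfield X (p * q) = rfield X p * q + p * rfield X q.
Proof. exact: vfieldM. Qed.

Lemma rfieldC X c : rfield X c%:MP = 0%:MP.
Proof. by rewrite /rfield vfieldC mpolyC0. Qed.

Lemma rfieldX X i : rfield X 'X_i = mxvec (cmx X *m gx) 0 i.
Proof. exact: vfieldX. Qed.

Lemma rfieldE X p : rfield X p = vfield (cmx X *m gx) p.
Proof. by []. Qed.

(** Both sides are derivations of q at 1, so coordinates suffice. The order of X and Y is reversed
    because the fields are right invariant. *)
Lemma mxdiff_bracket X Y q : mxdiff q 1%:M (lie_bracket X Y) =
  mxeval (rfield Y (rfield X q) - rfield X (rfield Y q)) 1%:M.
Proof.
elim/mpoly_alg_ind: q => [c|i|q r Eq Er|q r Eq Er].
- by rewrite mxdiffC !rfieldC subrr -mpolyC0 mxevalC.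
- have E (Z W : 'M[k]_n) : mxeval (rfield Z (rfield W 'X_i)) 1%:M = mxvec (W *m Z) 0 i.
    rewrite mxeval_rfield rfieldX.
    transitivity (mxvec (dmx 1%:M (Z *m 1%:M) (cmx W *m gx)) 0 i).
      by rewrite /dmx -map_mxvec [RHS]mxE.
    by rewrite dmxM dmx_cmx mul0mx add0r evmx_cmx dmx_generic mulmx1.
  rewrite mxevalB mxdiffX; transitivity (mxvec (X *m Y) 0 i - mxvec (Y *m X) 0 i).
    by rewrite linearB [LHS]mxE; congr (_ + _); rewrite mxE.
  by congr (_ - _); apply/esym/E.
- by rewrite mxdiffD Eq Er -mxevalD !rfieldD opprD [in RHS]addrACA.
- rewrite (commutator_Leibniz _ _ (@rfieldD X) (@rfieldD Y) (@rfieldM X)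
    (@rfieldM Y)).
  by rewrite mxdiffM Eq Er -!mxevalM -mxevalD.
Qed.

Lemma Ad1 X : Ad 1%:M X = X.
Proof. by rewrite /Ad invmx1 mul1mx mulmx1. Qed.

Lemma AdM a b X : a \in unitmx -> b \in unitmx -> Ad (a *m b) X = Ad a (Ad b X).
Proof.
move=> au bu; have abu : a *m b \in unitmx by rewrite unitmx_mul au.
have E : invmx (a *m b) = invmx b *m invmx a.
  by rewrite -[RHS](mulKmx abu) -mulmxA (mulmxA b) mulmxV// mul1mx mulmxV// mulmx1.
by rewrite /Ad E !mulmxA.
Qed.

Variable G : set 'M[k]_n.
Hypothesis Ggrp : closed_subgroup G.
Local Notation IG := (vanishing_ideal G).
Local Notation g := (lie_algebra G).

Lemma group_unit a : G a -> a \in unitmx.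
Proof. by case: Ggrp => _ _ _ -> []. Qed.

Lemma group_tangent X p a : X \in g -> IG p -> G a -> mxdiff p a (X *m a) = 0.
Proof.
move=> /mem_lie_algebra gX Ip Ga; have [_ GM _ _] := Ggrp.
have := gX (translate 1%:M a p); rewrite mxdiff_translate !mul1mx; apply => b Gb.
by rewrite mxeval_translate mul1mx; apply/Ip/GM.
Qed.

Lemma rfield_vanishing X p : X \in g -> IG p -> IG (rfield X p).
Proof. by move=> gX Ip a Ga; rewrite mxeval_rfield group_tangent. Qed.

Lemma lie_algebra_Ad a X : G a -> X \in g -> Ad a X \in g.
Proof.
move=> Ga /mem_lie_algebra gX; have [_ GM GV _] := Ggrp.
apply/mem_lie_algebra => p Ip; have au := group_unit Ga.
have := gX (translate a (invmx a) p); rewrite mxdiff_translate mulmx1 mulmxV//.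
apply=> b Gb; rewrite mxeval_translate; apply: Ip.
by apply: (GM); [apply: (GM)|apply: (GV)].
Qed.

Lemma lie_algebra_bracket X Y : X \in g -> Y \in g -> lie_bracket X Y \in g.
Proof.
move=> gX gY; apply/mem_lie_algebra => p Ip; have [G1 _ _ _] := Ggrp.
rewrite mxdiff_bracket.
exact: (idealB (vanishing_ideal_ideal G) (rfield_vanishing gY (rfield_vanishing gX Ip))
  (rfield_vanishing gX (rfield_vanishing gY Ip)) _ G1).
Qed.

(** The function a |-> p(a y a^-1) is zero on [G]; its derivative at 1 along X is that of p along
    [X, y]. *)
Lemma orbit_tangent p e y X : vanishing_ideal (Ad_orbit G e) p ->
  Ad_orbit G e y -> X \in g -> mxdiff p y (lie_bracket X y) = 0.
Proof.
move=> Ip [c Gc <-] gX; have [d [P PE]] := orbit_map_polynomial p (Ad c e).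
have [G1 GM _ _] := Ggrp.
have pAd a : G a -> mxeval p (Ad a (Ad c e)) = 0.
  by move=> Ga; apply: Ip; exists (a *m c); [exact: GM|rewrite AdM ?group_unit].
have IP : IG P.
  by move=> a Ga; have [-> _] := PE a (group_unit Ga); rewrite pAd// mulr0.
have [_ /(_ X)] := PE 1%:M (unitmx1 _ _).
rewrite (group_tangent gX IP G1) det1 expr1n mul1r pAd// mulr0 add0r.
by rewrite Ad1 => <-.
Qed.

Hypothesis char0 : [pchar k] =i pred0.
Hypothesis knoeth : noetherian k.

Local Notation y := (coordinate_at 1%:M).

(** By duality c is the differential at 1 of some q in the ideal of [G], and q differs from its
    linear part by second order terms. *)
Lemma cotangent_lift (c : 'rV[k]_(n * n)) :
  (forall X, X \in g -> \sum_i c 0 i * mxvec X 0 i = 0) ->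
  ipow_mod y IG 2 (\sum_i (c 0 i)%:MP * y i).
Proof.
move=> cg; have Iid := vanishing_ideal_ideal G; have [I0 ID IM] := Iid.
pose D : set 'rV[k]_(n * n) :=
  [set d | exists2 q, IG q & forall i, d 0 i = q^`M(i).@[mxvec 1%:M 0]].
have [q Iq cE] : D c.
  apply: double_annihilator.
  - by exists 0 => // i; rewrite mxE mderiv0 meval0.
  - move=> a u v [q Iq uE] [r Ir vE]; exists (a%:MP * q + r).
      by apply: (ID) => //; apply: IM.
    by move=> i; rewrite !mxE uE vE mderivD mderiv_mulC mevalD mevalM mevalC.
  - move=> v vD; apply/matrixP => i j; rewrite !ord1 [RHS]mxE.
    pose X := vec_mx v^T; have XE l : mxvec X 0 l = v l 0 by rewrite vec_mxK mxE.
    rewrite mxE; under eq_bigr do rewrite -XE.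
    apply: cg; apply/mem_lie_algebra => q Iq.
    pose d : 'rV[k]_(n * n) := \row_i q^`M(i).@[mxvec 1%:M 0].
    have /vD/matrixP/(_ 0 0) : D d by exists q => // l; rewrite mxE.
    rewrite !mxE => <-; apply: eq_bigr => l _; by rewrite XE mxE.
have -> : \sum_i (c 0 i)%:MP * y i = linear_part 1%:M q.
  by apply: eq_bigr => i _; rewrite cE.
have [G1 _ _ _] := Ggrp.
exists (- (q - (mxeval q 1%:M)%:MP - linear_part 1%:M q)).
  by rewrite -mulN1r; apply/ipow_Ml/taylor2.
by rewrite Iq// mpolyC0 subr0 opprK addrC subrK.
Qed.

(* With the formal Taylor expansion of P at 1 known to start in degree j, its
   leading form is j^-1 times the Euler field applied to it; the components of
   the Euler field along Lie G raise the order by the hypothesis on F, those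
   transversal to Lie G because linear forms vanishing on Lie G are
   differentials of elements of the ideal of G. *)
Lemma vanish_to_infinite_order (F : set S) :
  (forall P, F P -> mxeval P 1%:M = 0) ->
  (forall P X, F P -> X \in g -> F (rfield X P)) ->
  forall P, F P -> forall j, ipow_mod y IG j P.
Proof.
move=> F1 FX P FP j; elim: j P FP => [|j IHj] P FP.
  exact/ipow_modW/ipow_top/vanishing_ideal_ideal.
have Iid := vanishing_ideal_ideal G; have [I0 ID IM] := Iid.
(* The first order is treated apart, since the general step divides by the current order. *)
case: j IHj => [|j] IHj.
  apply: ipow_modW => //; have := taylor1 1%:M P.
  by rewrite F1// mpolyC0 subr0.
have Kid := ipow_mod_ideal y j.+2 Iid; have [_ KD KM] := Kid.
have [Q jQ IQ] := IHj P FP.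
suff KQ : ipow_mod y IG j.+2 (j.+1%:R * Q).
  rewrite -(subrK Q P); apply: (KD); first exact: ipow_mod_sub.
  have j0 : j.+1%:R != 0 :> k by rewrite ((pcharf0P k).1 char0).
  have -> : Q = (j.+1%:R^-1)%:MP * (j.+1%:R * Q).
    rewrite mulrA -[X in _ * X * _](rmorph_nat (@mpolyC (n * n) k)) -mpolyCM.
    by rewrite mulVf// mpolyC1 mul1r.
  exact: KM.
(* The constant field V may replace V a: their coefficients differ by elements of (y), which makes
   up for the order lost in differentiating Q. *)
have dQ V : V \in g -> ipow_mod y IG j.+1 (vfield (cmx V) Q).
  move=> gV; have K'id := ipow_mod_ideal y j.+1 Iid; have [_ K'D _] := K'id.
  have KXQ : ipow_mod y IG j.+1 (rfield V Q).
    have -> : rfield V Q = rfield V P - rfield V (P - Q).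
      by apply/eqP; rewrite eq_sym subr_eq addrC -rfieldD subrK.
    apply: idealB => //; first exact/IHj/FX.
    exact/ipow_mod_sub/rfield_vanishing.
  rewrite -(subrK (rfield V Q) (vfield _ _)); apply: K'D => //.
  apply: ipow_modW => //; rewrite rfieldE vfield.unlock -sumrB.
  apply: ideal_sum (ipow_ideal _ _) _ => i _; rewrite -mulrBl.
  apply: (@ipow_M _ _ _ 1 j); last exact: ipow_mderiv.
  rewrite -opprB; apply: idealN; first exact: ipow_ideal.
  have E : mxeval (mxvec (cmx V *m gx) 0 i) 1%:M = mxvec V 0 i.
    transitivity (mxvec (evmx 1%:M (cmx V *m gx)) 0 i).
      by rewrite /evmx -map_mxvec [RHS]mxE.
    by rewrite evmxM evmx_cmx evmx_generic mulmx1.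
  have := taylor1 1%:M (mxvec (cmx V *m gx) 0 i); rewrite E.
  by rewrite mxvec_cmx.
pose E i : 'M[k]_n := vec_mx (delta_mx 0 i).
(* The component transversal to Lie G. For fixed l, the linear form whose coefficients are the l-th
   entries of the W_i sends X to an entry of X minus its projection, so it vanishes on Lie G. *)
pose W i : 'M[k]_n := E i - projv g (E i).
have Edec (V : 'M[k]_n) : V = \sum_i mxvec V 0 i *: E i.
  rewrite -[LHS]mxvecK {1}[mxvec V]row_sum_delta linear_sum.
  by apply: eq_bigr => i _; rewrite linearZ.
have dE i : Q^`M(i) = vfield (cmx (projv g (E i))) Q + vfield (cmx (W i)) Q.
  have sumE l : mxvec (projv g (E i)) 0 l + mxvec (W i) 0 l = (i == l)%:R.
    have addE (A B : 'M[k]_n) : mxvec A 0 l + mxvec B 0 l = mxvec (A + B) 0 l.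
      by rewrite linearD [RHS]mxE.
    by rewrite addE addrC subrK vec_mxK mxE eqxx eq_sym.
  rewrite vfield.unlock -big_split (bigD1 i)//= big1 => [|l nl].
    by rewrite !mxvec_cmx -mulrDl -mpolyCD sumE eqxx mpolyC1 mul1r addr0.
  by rewrite !mxvec_cmx -mulrDl -mpolyCD sumE eq_sym (negPf nl) mpolyC0 mul0r.
have eulerE : \sum_i y i * Q^`M(i) =
    \sum_i y i * vfield (cmx (projv g (E i))) Q +
    \sum_l (\sum_i ((\row_i mxvec (W i) 0 l) 0 i)%:MP * y i) * Q^`M(l).
  under eq_bigr do rewrite dE mulrDr.
  rewrite big_split; congr (_ + _) => /=.
  under [RHS]eq_bigr do rewrite mulr_suml.
  rewrite [RHS]exchange_big; apply: eq_bigr => i _ /=.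
  rewrite vfield.unlock mulr_sumr; apply: eq_bigr => l _.
  by rewrite mxvec_cmx !mxE; ring.
rewrite -(subKr (\sum_i y i * Q^`M(i)) (_ * Q)); apply: idealB => //; last first.
  by apply: ipow_modW => //; apply: ipow_euler.
rewrite eulerE; apply: KD.
  apply: ideal_sum => // i _; rewrite mulrC -addn1.
  apply: ipow_mod_M => //; last exact: ipow1_gen.
  by apply/dQ/memv_proj.
apply: ideal_sum => // l _; apply: (@ipow_mod_M _ _ _ _ 2 j) => //; last first.
  exact: ipow_mderiv.
apply: cotangent_lift => X gX.
have XW : \sum_i mxvec X 0 i *: W i = 0.
  rewrite /W; under eq_bigr do rewrite scalerBr -[X in _ - X]linearZ.
  by rewrite sumrB -[X in _ - X]linear_sum -Edec /= projv_id// subrr.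
transitivity (mxvec (\sum_i mxvec X 0 i *: W i) 0 l); last by rewrite XW linear0 mxE.
rewrite linear_sum summxE; apply: eq_bigr => i _.
by rewrite linearZ !mxE mulrC.
Qed.

Lemma vanish_near_identity (F : set S) :
  (forall P, F P -> mxeval P 1%:M = 0) ->
  (forall P X, F P -> X \in g -> F (rfield X P)) ->
  forall P, F P -> exists2 s, mxeval s 1%:M <> 0 & IG (s * P).
Proof.
move=> F1 FX P FP; have Iid := vanishing_ideal_ideal G.
have [a a1 IPa] := krull_intersection (noetherian_mpoly (n := n * n) knoeth) Iid
  (vanish_to_infinite_order F1 FX FP).
exists (1 - a); last by rewrite mulrC.
rewrite mxevalB (mxeval_ipow a1) -mpolyC1 mxevalC subr0.
exact/eqP/oner_neq0.
Qed.

Inductive iterated_rfield P : S -> Prop :=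
| iterated_rfield_0 : iterated_rfield P P
| iterated_rfield_S X Q : X \in g -> iterated_rfield P Q ->
    iterated_rfield P (rfield X Q).

(* The points of G near which P vanishes are the common zeros in G of all the
   iterated derivatives of P, so they form an open and closed subset. *)
Lemma identity_principle P s b : zariski_connected G ->
  G b -> mxeval s b <> 0 -> IG (s * P) -> IG P.
Proof.
move=> conn Gb sb IsP; have Iid := vanishing_ideal_ideal G.
have [I0 ID IM] := Iid; have [G1 GM GV _] := Ggrp.
pose Z1 : set 'M[k]_n := [set A | forall Q, iterated_rfield P Q -> mxeval Q A = 0].
pose Z2 : set 'M[k]_n := [set A | forall t, IG (t * P) -> mxeval t A = 0].
have Z1c : zariski_closed Z1 by exact: zero_set_closed.
have Z2c : zariski_closed Z2 by exact: (zero_set_closed (fun t => IG (t * P))).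
have cover : G `<=` Z1 `|` Z2.
  move=> a Ga; case: (pselect (Z2 a)) => [|nZ2]; first by right.
  left=> Q DQ.
  have [t ItP ta] : exists2 t, IG (t * P) & mxeval t a <> 0.
    apply: contrapT => not; apply: nZ2 => t ItP; apply: contrapT => ta.
    by apply: not; exists t.
  (* As t P vanishes on [G], a power of t kills each iterated derivative of P; one more derivation
     doubles the exponent. *)
  have [e IteQ] : exists e, IG (t ^+ e * Q).
    elim: DQ => [|X Q' gX _ [e IteQ]]; first by exists 1%N; rewrite expr1.
    exists (e + e)%N.
    have -> : t ^+ (e + e) * rfield X Q' =
        t ^+ e * rfield X (t ^+ e * Q') - rfield X (t ^+ e) * (t ^+ e * Q').
      by rewrite rfieldM exprD; ring.
    apply: (idealB Iid); apply: IM => //; exact: rfield_vanishing.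
  have := IteQ a Ga; rewrite mxevalM mxevalXn => /eqP; rewrite mulf_eq0.
  by case/orP => [|/eqP//]; rewrite expf_eq0 => /andP[_ /eqP /ta].
have disj : G `&` (Z1 `&` Z2) = set0.
  apply/seteqP; split=> // a [Ga [Z1a Z2a]].
  have au := group_unit Ga.
  (* Right translation by [a] carries the derivatives of P to the identity. Asking for equality on
     [G] alone makes stability under [rfield] easy to check. *)
  pose F : set S := [set R | exists2 Q, iterated_rfield P Q &
    forall A, G A -> mxeval R A = mxeval Q (A *m a)].
  have F1 R : F R -> mxeval R 1%:M = 0.
    by move=> [Q DQ E]; rewrite E// mul1mx Z1a.
  have FX R X : F R -> X \in g -> F (rfield X R).
    move=> [Q DQ E] gX; exists (rfield X Q); first exact: iterated_rfield_S.
    have IRQ : IG (R - translate 1%:M a Q).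
      by move=> A GA; rewrite mxevalB E// mxeval_translate mul1mx subrr.
    move=> A GA; have := rfield_vanishing gX IRQ GA.
    rewrite !mxeval_rfield mxdiffB => /eqP; rewrite subr_eq0 => /eqP ->.
    by rewrite mxdiff_translate !mul1mx -mulmxA.
  have FP : F (translate 1%:M a P).
    exists P; first exact: iterated_rfield_0.
    by move=> A _; rewrite mxeval_translate mul1mx.
  have [t t1 It] := vanish_near_identity F1 FX FP.
  apply: t1; have := Z2a (translate 1%:M (invmx a) t).
  rewrite mxeval_translate mul1mx mulmxV//; apply=> A GA.
  have := It (A *m invmx a) (GM _ _ GA (GV _ Ga)); rewrite mxevalM.
  rewrite (mxeval_translate _ _ P) mul1mx mulmxKV// => E.
  by rewrite mxevalM (mxeval_translate _ _ t) mul1mx.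
case: (conn _ _ Z1c Z2c cover disj) => [GZ1|GZ2].
  by move=> a /GZ1; apply; apply: iterated_rfield_0.
by case: sb; apply: (GZ2 b Gb).
Qed.

End LieAlgebraOfGroup.

(** * Orbits of subgroups *)

Section AdjointAction.
Variables (k : fieldType) (n : nat).
Implicit Types (X Y Z : 'M[k]_n) (g h : {vspace 'M[k]_n}).

Lemma lie_bracket_linl c X Y Z :
  lie_bracket (c *: X + Y) Z = c *: lie_bracket X Z + lie_bracket Y Z.
Proof.
rewrite /lie_bracket mulmxDl mulmxDr -scalemxAl -scalemxAr scalerBr.
by rewrite opprD addrACA.
Qed.

Lemma lie_bracket_linr c X Y Z :
  lie_bracket Z (c *: X + Y) = c *: lie_bracket Z X + lie_bracket Z Y.
Proof.
rewrite /lie_bracket mulmxDl mulmxDr -scalemxAl -scalemxAr scalerBr.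
by rewrite opprD addrACA.
Qed.

Lemma lie_bracket_suml (I : finType) (c : I -> k) (F : I -> 'M[k]_n) Z :
  lie_bracket (\sum_i c i *: F i) Z = \sum_i c i *: lie_bracket (F i) Z.
Proof.
apply: (big_rec2 (fun V y => lie_bracket V Z = y)) => [|i y V _ <-].
  by rewrite /lie_bracket mul0mx mulmx0 subrr.
exact: lie_bracket_linl.
Qed.

Lemma lie_bracketC X Y : lie_bracket X Y = - lie_bracket Y X.
Proof. by rewrite /lie_bracket opprB. Qed.

Lemma Ad_lie_bracket a X Y : a \in unitmx ->
  Ad a (lie_bracket X Y) = lie_bracket (Ad a X) (Ad a Y).
Proof.
move=> au; rewrite /Ad /lie_bracket mulmxBr mulmxBl !mulmxA.
by rewrite !(mulmxKV au).
Qed.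

Lemma killing_linl g c X Y Z :
  killing g (c *: X + Y) Z = c * killing g X Z + killing g Y Z.
Proof.
rewrite /killing mulr_sumr -big_split; apply: eq_bigr => i _ /=.
by rewrite lie_bracket_linl linearP.
Qed.

Lemma killing_linr g c X Y Z :
  killing g Z (c *: X + Y) = c * killing g Z X + killing g Z Y.
Proof.
rewrite /killing mulr_sumr -big_split; apply: eq_bigr => i _ /=.
by rewrite lie_bracket_linl lie_bracket_linr linearP.
Qed.

Variable g : {vspace 'M[k]_n}.
Hypothesis g_bracket : forall X Y, X \in g -> Y \in g -> lie_bracket X Y \in g.
Local Notation b := (vbasis g).

Let bg (i : 'I_(\dim g)) : b`_i \in g.
Proof. by rewrite vbasis_mem// mem_nth// size_tuple. Qed.

(** The matrix of ad X acting on row vectors, whence the reversed products below. *)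
Let adm X : 'M[k]_(\dim g) := \matrix_(i, j) coord b j (lie_bracket X b`_i).

Let admE X Y i : X \in g -> Y \in g ->
  coord b i (lie_bracket X Y) = \sum_j coord b j Y * adm X j i.
Proof.
move=> gX gY; rewrite {1}(coord_vbasis gY) lie_bracketC lie_bracket_suml -sumrN.
rewrite linear_sum; apply: eq_bigr => j _.
by rewrite -scalerN -lie_bracketC linearZ mxE.
Qed.

Let killingE X Y : X \in g -> Y \in g -> killing g X Y = \tr (adm Y *m adm X).
Proof.
move=> gX gY; apply: eq_bigr => i _; rewrite mxE admE ?g_bracket//.
by apply: eq_bigr => j _; congr (_ * _); rewrite mxE.
Qed.

Let adm_bracket X Y : X \in g -> Y \in g ->
  adm (lie_bracket X Y) = adm Y *m adm X - adm X *m adm Y.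
Proof.
move=> gX gY; apply/matrixP => i j; rewrite [LHS]mxE.
have -> : lie_bracket (lie_bracket X Y) b`_i =
    lie_bracket X (lie_bracket Y b`_i) - lie_bracket Y (lie_bracket X b`_i).
  rewrite /lie_bracket !mulmxBl !mulmxBr !mulmxA !opprB.
  set A1 := X *m Y *m _; set A2 := Y *m X *m _; set A3 := _ *m X *m Y.
  set A4 := _ *m Y *m X; set A5 := X *m _ *m Y; set A6 := Y *m _ *m X.
  by apply/matrixP => u v; rewrite !mxE; ring.
rewrite linearB /= !admE ?g_bracket// !mxE.
by congr (_ - _); apply: eq_bigr => l _; congr (_ * _); rewrite mxE.
Qed.

Lemma killing_invariant X Y Z : X \in g -> Y \in g -> Z \in g ->
  killing g (lie_bracket X Y) Z = killing g X (lie_bracket Y Z).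
Proof.
move=> gX gY gZ; rewrite !killingE ?g_bracket// !adm_bracket// mulmxBl mulmxBr.
rewrite [LHS]linearB [RHS]linearB /= !mulmxA; congr (_ - _).
by rewrite -[in RHS]mulmxA [RHS]mxtrace_mulC.
Qed.

(* By invariance the orthogonal of [h, e] in g is {X | [X, e] in m}, so under
   the hypothesis it is the centralizer of e, whence
   dim [h, e] >= dim g - dim g^e = dim [g, e]. *)
Lemma bracket_span_eq h e X : e \in g -> (h <= g)%VS ->
  (forall X, X \in g -> (forall Y, Y \in h -> killing g (lie_bracket X e) Y = 0) ->
    lie_bracket X e = 0) ->
  X \in g -> exists2 Y, Y \in h & lie_bracket X e = lie_bracket Y e.
Proof.
move=> ge hg inj gX.
have bh (j : 'I_(\dim h)) : (vbasis h)`_j \in h.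
  by rewrite vbasis_mem// mem_nth// size_tuple.
pose E := \matrix_(i < \dim g) mxvec (lie_bracket b`_i e).
pose B := \matrix_(j < \dim h) mxvec (lie_bracket (vbasis h)`_j e).
(* The sign comes from moving e across the form, so that K B^T is the matrix of the pairing of
   [X, e] with Y, for X in g and Y in h. *)
pose K := \matrix_(i < \dim g, l < n * n) - killing g b`_i (vec_mx (delta_mx 0 l)).
have lin1 Y c U V : killing g (c *: U + V) Y = c * killing g U Y + killing g V Y.
  exact: killing_linl.
have lin2 Y c U V : killing g Y (c *: U + V) = c * killing g Y U + killing g Y V.
  exact: killing_linr.
have killN U V : killing g U (- V) = - killing g U V.
  by rewrite -[- V]addr0 -scaleN1r lin2 (linform0 (lin2 U)) addr0 mulN1r.
have rowE V : V = \sum_l mxvec V 0 l *: vec_mx (delta_mx 0 l).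
  rewrite -[LHS]mxvecK {1}[mxvec V]row_sum_delta linear_sum.
  by apply: eq_bigr => l _; rewrite linearZ.
have LE (u : 'rV_(\dim g)) j : (u *m (K *m B^T)) 0 j =
    killing g (lie_bracket (\sum_i u 0 i *: b`_i) e) (vbasis h)`_j.
  rewrite lie_bracket_suml (linform_sum (lin1 _)) mxE.
  apply: eq_bigr => i _; congr (_ * _).
  rewrite (killing_invariant (bg i) ge (subvP hg _ (bh j))) lie_bracketC killN.
  rewrite [lie_bracket _ e]rowE (linform_sum (lin2 _)) mxE -sumrN.
  by apply: eq_bigr => l _; rewrite !mxE mulNr mulrC.
have kerE : (kermx (K *m B^T) <= kermx E)%MS.
  apply/row_subP => r; set u := row r _.
  have uL : u *m (K *m B^T) = 0 by rewrite -row_mul mulmx_ker linear0.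
  have gu : \sum_i u 0 i *: b`_i \in g.
    by apply: memv_suml => i _; apply: memvZ.
  have u0 : lie_bracket (\sum_i u 0 i *: b`_i) e = 0.
    apply: inj => // Y hY; rewrite (coord_vbasis hY) (linform_sum (lin2 _)).
    by rewrite big1// => j _; rewrite -LE uL mxE mulr0.
  apply/sub_kermxP; rewrite mulmx_sum_row -[RHS](linear0 mxvec) -[0 in RHS]u0.
  rewrite lie_bracket_suml linear_sum; apply: eq_bigr => i _.
  by rewrite linearZ rowK.
have rkEB : (\rank E <= \rank B)%N.
  apply: leq_trans (_ : \rank (K *m B^T) <= _)%N; last first.
    by rewrite -mxrank_tr trmx_mul trmxK mxrankM_maxl.
  have := mxrankS kerE; rewrite !mxrank_ker leq_sub2lE// rank_leq_row//.
have mxbr (d : nat) (c : 'rV[k]_d) (F : 'I_d -> 'M[k]_n) :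
    mxvec (lie_bracket (\sum_i c 0 i *: F i) e) =
    c *m \matrix_i mxvec (lie_bracket (F i) e).
  rewrite mulmx_sum_row lie_bracket_suml linear_sum; apply: eq_bigr => i _.
  by rewrite linearZ rowK.
have inE Z : Z \in g -> (mxvec (lie_bracket Z e) <= E)%MS.
  move=> gZ; apply/submxP; exists (\row_i coord b i Z); rewrite -mxbr.
  by congr (mxvec (lie_bracket _ _)); rewrite [LHS](coord_vbasis gZ);
    apply: eq_bigr => i _; rewrite mxE.
have subBE : (B <= E)%MS.
  by apply/row_subP => j; rewrite rowK inE// (subvP hg).
have subEB : (E <= B)%MS.
  by rewrite -(mxrank_leqif_sup subBE) eqn_leq rkEB mxrankS.
have /submxP[v vE] := submx_trans (inE X gX) subEB.
exists (\sum_j v 0 j *: (vbasis h)`_j).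
  by apply: memv_suml => j _; apply: memvZ.
by apply: (can_inj mxvecK); rewrite vE mxbr.
Qed.

End AdjointAction.

(** * Density of a subgroup orbit from equality of tangent spaces *)

Section OrbitsOfSubgroups.
Variables (k : fieldType) (n : nat).
Hypotheses (char0 : [pchar k] =i pred0).
Local Notation S := {mpoly k[n * n]}.
Local Notation gx := (generic_mx k n).
Implicit Types (p q P : S) (a x X Y : 'M[k]_n).

Lemma lie_algebraS (G H : set 'M[k]_n) :
  H `<=` G -> (lie_algebra H <= lie_algebra G)%VS.
Proof.
move=> HG; apply/subvP => X /mem_lie_algebra hX; apply/mem_lie_algebra => p Ip.
by apply: hX => A HA; apply/Ip/HG.
Qed.

Lemma closure_orbit_lie_algebra (G : set 'M[k]_n) e x : closed_subgroup G ->
  e \in lie_algebra G -> zariski_closure (Ad_orbit G e) x -> x \in lie_algebra G.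
Proof.
move=> Ggrp ge clx; apply/mem_lie_algebra => p Ip.
have lin c X Y : mxdiff p 1%:M (c *: X + Y) = c * mxdiff p 1%:M X + mxdiff p 1%:M Y.
  exact: mxdiff_lin.
rewrite -(mxeval_linform lin); apply: clx => _ [a Ga <-].
rewrite mxeval_linform//; have /mem_lie_algebra := lie_algebra_Ad Ggrp Ga ge.
exact.
Qed.

(* The vector field x |-> [X, x] generated by the adjoint action. *)
Definition adfield X : 'M[S]_n := cmx X *m gx - gx *m cmx X.

Lemma evmx_adfield X x : evmx x (adfield X) = lie_bracket X x.
Proof.
rewrite /evmx /adfield map_mxB -!/(evmx x _).
by rewrite !evmxM !evmx_cmx evmx_generic.
Qed.

Lemma dense_orbit_of_tangent (G H : set 'M[k]_n) x :
  closed_subgroup G -> zariski_connected G -> closed_subgroup H -> H `<=` G ->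
  (forall X, X \in lie_algebra G -> exists2 Y, Y \in lie_algebra H &
    lie_bracket X x = lie_bracket Y x) ->
  Ad_orbit G x `<=` zariski_closure (Ad_orbit H x).
Proof.
move=> Ggrp conn Hgrp HG tan _ [a Ga <-] p Jp.
have [G1 GM GV _] := Ggrp; have [H1 _ HV _] := Hgrp.
pose J := vanishing_ideal (Ad_orbit H x).
have Jad q X : J q -> X \in lie_algebra G -> J (vfield (adfield X) q).
  move=> Jq gX y Hy; rewrite mxeval_vfield evmx_adfield.
  have [c Hc cy] := Hy; have cu := group_unit Hgrp Hc.
  (* The hypothesis at x is carried to y = c x c^-1 by applying it to X conjugated by c^-1. *)
  have [Y hY XY] := tan _ (lie_algebra_Ad Ggrp (GV _ (HG _ Hc)) gX).
  have -> : lie_bracket X y = lie_bracket (Ad c Y) y.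
    rewrite -cy -Ad_lie_bracket// -XY Ad_lie_bracket//; congr lie_bracket.
    by rewrite -AdM ?unitmx_inv// mulmxV// Ad1.
  exact: (orbit_tangent Hgrp Jq Hy (lie_algebra_Ad Hgrp Hc hY)).
pose F : set S := [set P | exists d q, J q /\
  forall a, G a -> mxeval P a = \det a ^+ d * mxeval q (Ad a x)].
have F1 P : F P -> mxeval P 1%:M = 0.
  move=> [d [q [Jq PE]]]; rewrite PE// Ad1 Jq ?mulr0//.
  by exists 1%:M => //; rewrite Ad1.
have FX P X : F P -> X \in lie_algebra G -> F (rfield X P).
  move=> [d [q [Jq PE]]] gX.
  have [d0 [P0 P0E]] := orbit_map_polynomial q x.
  exists d, ((d%:R * det_diff X)%:MP * q + vfield (adfield X) q); split.
    by have [_ JD JM] := vanishing_ideal_ideal (Ad_orbit H x);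
      apply: JD; [apply: JM|apply: Jad].
  move=> b Gb; have bu := group_unit Ggrp Gb.
  (* P is controlled only by its values on [G]. As R vanishes there, so do its derivatives along
     [G], and the derivative of P is read off from that of P0. *)
  pose R := \det gx ^+ d0 * P - \det gx ^+ d * P0.
  have IR : vanishing_ideal G R.
    move=> c Gc; have [P0c _] := P0E c (group_unit Ggrp Gc).
    rewrite /R mxevalB (mxevalM _ P) (mxevalM _ P0) !mxevalXn mxeval_det.
    by rewrite PE// P0c; ring.
  have := group_tangent Ggrp gX IR Gb; have [P0b P0b'] := P0E b bu.
  rewrite /R mxdiffB (mxdiffM _ P) (mxdiffM _ P0) !mxdiff_detX !mxevalXn.
  rewrite mxeval_det P0b P0b' PE// mxeval_rfield mxevalD (mxevalM _ q) mxevalC.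
  rewrite mxeval_vfield evmx_adfield.
  set D := \det b; set w := mxdiff P _ _; set v := mxdiff q _ _; set t := det_diff X.
  set r := mxeval q _ => E.
  have D0 : D ^+ d0 != 0 by rewrite expf_eq0 negb_and -unitfE -unitmxE bu orbT.
  apply: (mulfI D0); apply/eqP; rewrite -subr_eq0; apply/eqP.
  by rewrite -E; ring.
have [d [P PE]] := orbit_map_polynomial p x.
have FP : F P.
  by exists d, p; split=> // b Gb; have [] := PE b (group_unit Ggrp Gb).
have knoeth := @field_noetherian k.
have [s s1 IsP] := vanish_near_identity Ggrp char0 knoeth F1 FX FP.
have IP := identity_principle Ggrp char0 knoeth conn G1 s1 IsP.
have au := group_unit Ggrp Ga; have [Pa _] := PE a au.
have /eqP := IP a Ga; rewrite Pa mulf_eq0 expf_eq0 => /orP[/andP[_]|/eqP//].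
by rewrite -[_ == 0]negbK -unitfE -unitmxE au.
Qed.

End OrbitsOfSubgroups.

(** * Transversality *)

Section FiniteSpan.
Variables (k : comNzRingType) (N s : nat).
Local Notation S := {mpoly k[N]}.
Variables (y : 'I_s -> S) (I : set S) (d : nat).
Hypothesis Iid : ideal I.
Hypothesis nilp : forall i, ipow_mod y I 1 ('X_i ^+ d.+1).
Local Notation theta := (mmap (@mpolyC N k) y).

(** A monomial with an exponent above d lies in I + (y) by [nilp], which leaves finitely many. *)
Lemma monomials_span f :
  let w (e : 'I_#|{ffun 'I_N -> 'I_d.+1}|) : S := \prod_i 'X_i ^+ (enum_val e i) in
  exists c, ipow_mod y I 1 (f - \sum_e theta (c e) * w e).
Proof.
move=> w; have [K0 KD KM] := ipow_mod_ideal y 1 Iid.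
have sum0 : \sum_e theta 0 * w e = 0.
  by rewrite big1// => e _; rewrite rmorph0 mul0r.
pose Sp : set S := [set f | exists c, ipow_mod y I 1 (f - \sum_e theta (c e) * w e)].
have SpD p q : Sp p -> Sp q -> Sp (p + q).
  move=> [c Kc] [c' Kc']; exists (fun e => c e + c' e).
  have -> : \sum_e theta (c e + c' e) * w e =
      \sum_e theta (c e) * w e + \sum_e theta (c' e) * w e.
    by rewrite -big_split; apply: eq_bigr => e _; rewrite rmorphD mulrDl.
  exact: (idealBD (ipow_mod_ideal y 1 Iid) Kc Kc').
suff SpX a m : Sp (a%:MP * 'X_[m]).
  suff : Sp f by [].
  elim/mpolyind: f => [|a m p _ _ Spp]; first by exists (fun=> 0); rewrite sum0 subr0.
  by rewrite -mul_mpolyC; apply: SpD.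
rewrite mpolyXE_id.
have [small|[i big]] : (forall i, m i < d.+1)%N \/ exists i, (d.+1 <= m i)%N.
  case: (pselect (exists i, d.+1 <= m i)%N) => [|nobig]; [by right|left=> i].
  by rewrite ltnNge; apply/negP => big; apply: nobig; exists i; rewrite big.
- pose e0 := enum_rank [ffun i => Ordinal (small i)].
  exists (fun e => if e == e0 then a%:MP else 0).
  have -> : \sum_e theta (if e == e0 then a%:MP else 0) * w e = a%:MP * w e0.
    rewrite (bigD1 e0)//= eqxx mmapC [X in _ + X]big1 ?addr0// => e ne.
    by rewrite (negPf ne) rmorph0 mul0r.
  rewrite /w enum_rankK; under [X in _ - _ * X]eq_bigr do rewrite ffunE.
  by rewrite /= subrr; apply: K0.
- exists (fun=> 0); rewrite sum0 subr0 (bigD1 i)//= -(subnK big) exprD.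
  by apply: (KM); rewrite mulrAC; apply: (KM); apply: nilp.
Qed.

End FiniteSpan.

Section TransversalPoint.
Variables (k : closedFieldType) (n : nat).
Hypothesis char0 : [pchar k] =i pred0.
Local Notation S := {mpoly k[n * n]}.
Local Notation gx := (generic_mx k n).
Implicit Types (p q P : S) (a x X Y : 'M[k]_n).

(* Local form of the theorem on the dimension of fibres: a vector field D on Z
   tangent to the fibres of (l_1, .., l_s) is zero near an isolated point of
   the fibre over 0. *)
Lemma tangent_field_vanishes (Z : set 'M[k]_n) s (l : 'I_s -> 'M[k]_n -> k)
    (B : 'M[S]_n) z :
  (forall j c X Y, l j (c *: X + Y) = c * l j X + l j Y) ->
  (forall x, zariski_closure Z x -> (forall j, l j x = 0) -> x = 0) ->
  (forall p, vanishing_ideal Z p -> vanishing_ideal Z (vfield B p)) ->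
  (forall j x, Z x -> l j (evmx x B) = 0) ->
  exists m q, mxeval q 0 <> 0 /\ vanishing_ideal Z (vfield B z ^+ m * q).
Proof.
move=> lin zero BZ Bl; pose I := vanishing_ideal Z.
have Iid : ideal I := vanishing_ideal_ideal Z; have [I0 ID IM] := Iid.
pose y j : S := linform (l j).
have By j : I (vfield B (y j)).
  by move=> x Zx; rewrite mxeval_vfield mxdiff_linform// Bl.
have K1id := ipow_mod_ideal y 1 Iid; have [K0 KD KM] := K1id.
(* The zeros of I + (y) are the points of the closure of Z in the fibre over 0, hence at most 0,
   where every coordinate vanishes. *)
have nilp i : exists d, ipow_mod y I 1 ('X_i ^+ d).
  apply: nullstellensatz => // v Kv.
  pose A : 'M[k]_n := vec_mx (\row_i v i).
  have AE p : p.@[v] = mxeval p A.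
    by apply: meval_eq => j; rewrite vec_mxK mxE.
  suff A0 : A = 0 by rewrite AE A0 mxevalX linear0 mxE.
  apply: zero => [p Ip|j].
    by rewrite -AE; apply/Kv/ipow_mod_sub.
  rewrite -(mxeval_linform (lin j)) -AE; apply: Kv.
  exact/ipow_modW/ipow1_gen.
pose dd i := sval (cid (nilp i)); pose d := \max_i dd i.
have nilpd i : ipow_mod y I 1 ('X_i ^+ d.+1).
  have led : (dd i <= d.+1)%N by rewrite leqW// leq_bigmax.
  by rewrite -(subnK led) exprD; apply: KM; rewrite /dd; case: cid.
pose w (e : 'I_#|{ffun 'I_(n * n) -> 'I_d.+1}|) : S :=
  \prod_i 'X_i ^+ (enum_val e i).
pose theta : {rmorphism {mpoly k[s]} -> S} := mmap (@mpolyC (n * n) k) y.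
have thetaX i : theta 'X_i = y i by rewrite /theta/= mmapX mmap1U.
have thetaC c : theta c%:MP = c%:MP by rewrite /theta/= mmapC.
have Dtheta c : I (vfield B (theta c)).
  elim/mpoly_alg_ind: c => [c|i|p q Ip Iq|p q Ip Iq].
  - by rewrite thetaC vfieldC.
  - by rewrite thetaX.
  - by rewrite rmorphD vfieldD; apply: ID.
  - by rewrite rmorphM vfieldM; apply: (ID); [exact: (idealMr _ Iid)|apply: (IM)].
have w1 : w (enum_rank [ffun=> ord0]) = 1.
  by rewrite /w enum_rankK big1// => i _; rewrite ffunE expr0.
have Kpow j := derivation_pow_ipow (@vfieldD _ _ B) (@vfieldM _ _ B) Iid BZ Dtheta
  thetaX (monomials_span Iid nilpd) z j w1.
have noeth := noetherian_mpoly (n := n * n) (@field_noetherian k).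
have [a a1 Ia] := krull_intersection noeth Iid Kpow.
set m := _.*2 in Ia; set f := _`!%:R in Ia.
(* [a] vanishes at 0, as it lies in the ideal of the linear forms, so the second factor takes the
   nonzero value f there. *)
exists m, (f * (1 - a)); split; last by rewrite mulrA.
have a0 : mxeval a 0 = 0.
  apply: (@ipow_rmorph0 _ _ _ _ (meval (mxvec 0 0))) a1 => j.
  transitivity (mxeval (y j) 0) => //; rewrite mxeval_linform//.
  exact: linform0 (lin j).
rewrite mxevalM mxevalB a0 -mpolyC1 mxevalC subr0 mulr1 /f.
rewrite -(rmorph_nat (@mpolyC (n * n) k)) mxevalC.
by apply/eqP; rewrite ((pcharf0P k).1 char0) -lt0n fact_gt0.
Qed.

(* At a point x0 where the rank of X |-> (l_j [X, x])_j is maximal, every X in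
   its kernel extends to a polynomial family of kernel vectors, that is, to a
   vector field along the orbit tangent to the fibres of (l_1, .., l_s). *)
Lemma transversal_point (G : set 'M[k]_n) e s (l : 'I_s -> 'M[k]_n -> k) :
  closed_subgroup G -> zariski_connected G ->
  (forall j c X Y, l j (c *: X + Y) = c * l j X + l j Y) ->
  zariski_closure (Ad_orbit G e) 0 ->
  (forall x, zariski_closure (Ad_orbit G e) x -> (forall j, l j x = 0) -> x = 0) ->
  exists2 x0, Ad_orbit G e x0 & forall X, X \in lie_algebra G ->
    (forall j, l j (lie_bracket X x0) = 0) -> lie_bracket X x0 = 0.
Proof.
move=> Ggrp conn lin cl0 zero; have [G1 _ _ _] := Ggrp.
pose O := Ad_orbit G e; pose g := lie_algebra G.
have bg (i : 'I_(\dim g)) : (vbasis g)`_i \in g.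
  by rewrite vbasis_mem// mem_nth// size_tuple.
have linL i j c X Y : l j (lie_bracket (vbasis g)`_i (c *: X + Y)) =
    c * l j (lie_bracket (vbasis g)`_i X) + l j (lie_bracket (vbasis g)`_i Y).
  by rewrite lie_bracket_linr lin.
pose L : 'M[S]_(\dim g, s) :=
  \matrix_(i, j) linform (fun x => l j (lie_bracket (vbasis g)`_i x)).
have LE x i j : evmx x L i j = l j (lie_bracket (vbasis g)`_i x).
  by rewrite !mxE; apply: (mxeval_linform (linL i j)).
pose rk r := `[< exists2 x, O x & \rank (evmx x L) = r >].
have exrk : exists r, rk r.
  by exists (\rank (evmx e L)); apply/asboolP; exists e => //; exists 1%:M; rewrite ?Ad1.
have rkb r : rk r -> (r <= \dim g)%N.
  by move=> /asboolP[x _ <-]; apply: rank_leq_row.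
have [r /asboolP[x0 Ox0 rkx0] rmax] := ex_maxnP exrk rkb.
exists x0 => // X gX Xl; apply: contrapT => /eqP X0.
pose u0 : 'rV[k]_(\dim g) := \row_i coord (vbasis g) i X.
have u0X : X = \sum_i u0 0 i *: (vbasis g)`_i.
  by rewrite [LHS](coord_vbasis gX); apply: eq_bigr => i _; rewrite mxE.
have rowL (u : 'rV[k]_(\dim g)) x j : (u *m evmx x L) 0 j =
    l j (lie_bracket (\sum_i u 0 i *: (vbasis g)`_i) x).
  rewrite lie_bracket_suml (linform_sum (lin j)) mxE.
  by apply: eq_bigr => i _; rewrite LE.
have rkle x : O x -> (\rank (evmx x L) <= \rank (evmx x0 L))%N.
  by move=> Ox; rewrite rkx0; apply: rmax; apply/asboolP; exists x.
have u0L : u0 *m evmx x0 L = 0.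
  by apply/matrixP => i j; rewrite ord1 rowL -u0X Xl mxE.
have [u ux0 uL] := @generic_kernel_vector S k (@mpolyC (n * n) k) 'M[k]_n
  (fun x => meval (mxvec x 0)) (fun x c => mevalC _ c) _ _ L O x0 u0 rkle u0L.
pose B : 'M[S]_n := \sum_i u 0 i *: adfield (vbasis g)`_i.
pose V x := \sum_i evmx x u 0 i *: (vbasis g)`_i.
have gV x : V x \in g by apply: memv_suml => i _; apply: memvZ.
have BE x : evmx x B = lie_bracket (V x) x.
  rewrite lie_bracket_suml /evmx /B raddf_sum; apply: eq_bigr => i _ /=.
  by rewrite map_mxZ -/(evmx x _) evmx_adfield mxE.
have BO p : vanishing_ideal O p -> vanishing_ideal O (vfield B p).
  by move=> Ip x Ox; rewrite mxeval_vfield BE (orbit_tangent Ggrp Ip Ox).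
have Bl j x : O x -> l j (evmx x B) = 0.
  move=> Ox; rewrite BE -rowL; have := uL x Ox; rewrite map_mxM => ->.
  by rewrite mxE.
have [i z0] : exists i, mxvec (lie_bracket X x0) 0 i != 0.
  apply: contrapT => no; case/eqP: X0; apply: (can_inj mxvecK).
  rewrite linear0; apply/matrixP => r' i; rewrite ord1 [RHS]mxE; apply/eqP.
  by apply: contrapT => /negP ne; apply: no; exists i.
have [m [q [q0 Iq]]] := @tangent_field_vanishes O s l B 'X_i lin zero BO Bl.
have [x1 Ox1 q1] : exists2 x1, O x1 & mxeval q x1 <> 0.
  apply: contrapT => no; apply/q0/cl0 => x Ox.
  by apply: contrapT => qx; apply: no; exists x.
have [d1 [P1 P1E]] := orbit_map_polynomial (vfield B 'X_i ^+ m) e.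
have [d2 [P2 P2E]] := orbit_map_polynomial q e.
have knoeth := @field_noetherian k.
have [b Gb bx1] := Ox1; have [c Gc cx0] := Ox0.
have nz a : G a -> \det a != 0.
  by move=> Ga; rewrite -unitfE -unitmxE (group_unit Ggrp Ga).
have [P2b _] := P2E b (group_unit Ggrp Gb).
have [P1c _] := P1E c (group_unit Ggrp Gc).
(* The product of the pullbacks of (D z)^m and q is zero on [G], and that of q is nonzero at b, so
   that of (D z)^m vanishes near b, hence everywhere. *)
have IP1 : vanishing_ideal G P1.
  apply: (identity_principle (s := P2) (b := b) Ggrp char0 knoeth conn) => //.
    rewrite P2b bx1; apply/eqP; rewrite mulf_neq0 ?expf_neq0 ?nz//.
    exact/eqP.
  move=> a Ga; have au := group_unit Ggrp Ga.
  have [P2a _] := P2E a au; have [P1a _] := P1E a au.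
  rewrite (mxevalM P2) P2a P1a mulrACA [X in _ * X]mulrC -(mxevalM _ q).
  by rewrite Iq ?mulr0//; exists a.
have /eqP := IP1 c Gc; rewrite P1c cx0 mxevalXn mxeval_vfield BE mxdiffX.
rewrite mulf_eq0 !expf_eq0 (negPf (nz c Gc)) andbF /= => /andP[_].
have -> : V x0 = X by rewrite /V [evmx x0 u]ux0 -u0X.
by rewrite (negPf z0).
Qed.

End TransversalPoint.

Theorem theorem3p9 (k : closedFieldType) (char0 : [pchar k] =i pred0)
    (n : nat) (G H O : set 'M[k]_n) :
  simple_algebraic_group G ->
  reductive_group H -> zariski_connected H -> H `<=` G ->
  let g := lie_algebra G in
  let h := lie_algebra H in
  let m := killing_perp g h in
  (h + m)%VS = g -> directv (h + m) ->
  nilpotent_orbit G O ->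
  zariski_closure O `&` [set X | X \in m] = [set 0] ->
  has_dense_orbit H O.
Proof.
move=> [Ggrp conn _ _] [Hgrp _] _ HG g h m _ _ [e [ge _ ->]] Om0.
(* These forms stand for the projection onto h: their common kernel in g is m. *)
pose l (j : 'I_(\dim h)) X := killing g X (vbasis h)`_j.
have lin j c X Y : l j (c *: X + Y) = c * l j X + l j Y.
  exact: killing_linl.
have lh X : (forall j, l j X = 0) -> forall Y, Y \in h -> killing g X Y = 0.
  move=> lX Y hY; rewrite (coord_vbasis hY).
  rewrite (linform_sum (fun c U V => killing_linr g c U V X)) big1// => j _.
  by rewrite [X in _ * X]lX mulr0.
have cl0 : zariski_closure (Ad_orbit G e) 0.
  by have [] : (zariski_closure (Ad_orbit G e) `&` [set X | X \in m]) 0 by rewrite Om0.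
have zero x : zariski_closure (Ad_orbit G e) x -> (forall j, l j x = 0) -> x = 0.
  move=> clx lx; suff : (zariski_closure (Ad_orbit G e) `&` [set X | X \in m]) x.
    by rewrite Om0.
  split=> //=; apply/mem_killing_perp; split; last exact: lh.
  exact: closure_orbit_lie_algebra clx.
have [x0 Ox0 tr] := transversal_point char0 Ggrp conn lin cl0 zero.
have [a Ga ax0] := Ox0.
have gx0 : x0 \in g by rewrite -ax0 lie_algebra_Ad.
have [_ GM GV _] := Ggrp.
have Ox0E : Ad_orbit G e = Ad_orbit G x0.
  apply/seteqP; split=> _ [b Gb <-].
    exists (b *m invmx a); first exact/GM/GV.
    rewrite -ax0 -AdM ?unitmx_mul ?unitmx_inv ?(group_unit Ggrp)//.
    by rewrite mulmxKV// (group_unit Ggrp).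
  exists (b *m a); first exact: GM.
  by rewrite AdM ?(group_unit Ggrp)// ax0.
exists x0 => //; rewrite Ox0E; split.
  by move=> _ [b Hb <-]; exists b => //; apply: HG.
apply: dense_orbit_of_tangent => // X gX.
apply: (bracket_span_eq (g := g)) => //.
- exact: lie_algebra_bracket.
- exact: lie_algebraS.
- move=> Y gY Yh; apply: tr => // j; apply: Yh.
  by rewrite vbasis_mem// mem_nth// size_tuple.
Qed.
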